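(* Let $\Omega\subset\mathbb{H}$ be an axially symmetric domain, let $\lambda,\mu\in\mathbb{H}$, and consider the equation $\mathcal{D}_\mu\mathcal{D}_\lambda f=0$ on $\Omega$ with $f\in\mathcal{SR}(\Omega)$. Let $g^{\mu,\lambda}(x)=\sum_{n=1}^{+\infty}\frac{x^n}{n!}\sum_{k=0}^{n-1}\mu^k\lambda^{n-k-1}$. (1) If $\lambda\neq\mu$, then $g^{\mu,\lambda}$ is a solution, and any solution is of the form $f=h_1\cdot g^{\mu,\lambda}+h_2\cdot\exp_\lambda(x)$ with $h_1,h_2\in\mathcal{SC}(\Omega)$. (2) If $\lambda$ and $\mu$ are distinct and commute, then the solutions are the functions of the form $f=h_1\cdot\exp_\mu(x)+h_2\cdot\exp_\lambda(x)$ with $h_1,h_2\in\mathcal{SC}(\Omega)$. (3) If $\lambda=\mu$, then the solutions, i.e. the functions $f\in\mathcal{SR}(\Omega)$ such that $\mathcal{D}_\lambda^2f=0$, are the functions of the form $f=h_1\cdot\exp_\lambda(x)+h_2\cdot(x\exp_\lambda(x))$ with $h_1,h_2\in\mathcal{SC}(\Omega)$.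
   Context: $\mathbb{H}$ is the skew field of quaternions, $\mathbb{S}=\{J\in\mathbb{H}: J^2=-1\}$; the convention $\lambda^0=1$ is used for every $\lambda\in\mathbb{H}$. For an open set $D\subseteq\mathbb{C}$ invariant under complex conjugation, put $\Omega_D=\{\alpha+J\beta:\ \alpha+i\beta\in D,\ J\in\mathbb{S}\}\subseteq\mathbb{H}$. An axially symmetric domain is a connected open set $\Omega=\Omega_D$ of this form. A stem function on $D$ is a map $F=F_1+\imath F_2:D\to\mathbb{H}\otimes_{\mathbb{R}}\mathbb{C}$ ($F_1,F_2$ $\mathbb{H}$-valued, $\imath$ the central imaginary unit of the factor $\mathbb{C}$) with $F(\overline z)=\overline{F(z)}$, conjugation acting on the factor $\mathbb{C}$. It induces the slice function $f=\mathcal{I}(F):\Omega_D\to\mathbb{H}$, $f(\alpha+J\beta)=F_1(\alpha+i\beta)+JF_2(\alpha+i\beta)$. For $F$ of class $C^1$, the slice derivative is $\frac{\partial f}{\partial x}=\mathcal{I}(\frac{\partial F}{\partial z})$ with $\frac{\partial}{\partial z}=\frac12(\partial_\alpha-\imath\partial_\beta)$. $f$ is slice-regular if $F$ is holomorphic, i.e. $\frac12(\partial_\alpha+\imath\partial_\beta)F=0$; $\mathcal{SR}(\Omega)$ is the set of slice-regular functions. $\mathcal{SC}(\Omega)$ is the set of slice-constant functions: slice-regular $g$ with $\frac{\partial g}{\partial x}=0$. The slice product of $f=\mathcal{I}(F)$, $g=\mathcal{I}(G)$ is $f\cdot g=\mathcal{I}(FG)$, with $FG$ the pointwise product in $\mathbb{H}\otimes\mathbb{C}$.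 For $\lambda\in\mathbb{H}$, $\exp_\lambda(x)=\sum_{n=0}^{+\infty}\frac{x^n\lambda^n}{n!}$, and $\mathcal{D}_\lambda f=\frac{\partial f}{\partial x}-f\lambda$ (pointwise right multiplication by $\lambda$). The series defining $g^{\mu,\lambda}$ converges uniformly on compact sets of $\mathbb{H}$ to an entire slice-regular function. *)

(* Defs.v *)
From HB Require Import structures.
From mathcomp Require Import all_boot all_order all_algebra.
From mathcomp Require Import complex ring lra.
From mathcomp Require Import all_classical all_reals all_analysis.

Set Implicit Arguments.
Unset Strict Implicit.
Unset Printing Implicit Defensive.
Import Order.TTheory GRing.Theory Num.Theory.
Import numFieldNormedType.Exports.
Local Open Scope classical_set_scope.
Local Open Scope ring_scope.
Local Open Scope complex_scope.

(* The usual topology of the complex plane. *)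
HB.instance Definition _ (R : realType) := NormedModule.copy R[i] R[i]^o.

(* The quaternion a + b i + c j + d k is the nested pair (a, b, c, d).  The
   topology is that of R^4; the norm that comes with it is the sup norm, NOT
   the quaternionic modulus, and only its topology is used below. *)
Definition quat (R : realType) : Type := (R * R * R * R)%type.

HB.instance Definition _ (R : realType) :=
  NormedModule.copy (quat R) (R * R * R * R)%type.

Section quaternions.
Variable R : realType.
Implicit Types p q : quat R.

Definition qre q : R := q.1.1.1.
Definition qi q : R := q.1.1.2.
Definition qj q : R := q.1.2.
Definition qk q : R := q.2.

Definition quat_one : quat R := (1, 0, 0, 0).

Definition quat_mul p q : quat R :=
  (qre p * qre q - qi p * qi q - qj p * qj q - qk p * qk q,
   qre p * qi q + qi p * qre q + qj p * qk q - qk p * qj q,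
   qre p * qj q - qi p * qk q + qj p * qre q + qk p * qi q,
   qre p * qk q + qi p * qj q - qj p * qi q + qk p * qre q).

Lemma quat_eqP p q :
  qre p = qre q -> qi p = qi q -> qj p = qj q -> qk p = qk q -> p = q.
Proof.
case: p q => [[[? ?] ?] ?] [[[? ?] ?] ?]; rewrite /qre /qi /qj /qk /=.
by move=> -> -> -> ->.
Qed.

Local Ltac quat_ring :=
  apply: quat_eqP; rewrite /quat_mul /qre /qi /qj /qk /=; ring.

Lemma quat_mulA : associative quat_mul.
Proof. by move=> p q r; quat_ring. Qed.
Lemma quat_mul1l : left_id quat_one quat_mul.
Proof. by move=> p; quat_ring. Qed.
Lemma quat_mul1r : right_id quat_one quat_mul.
Proof. by move=> p; quat_ring. Qed.
Lemma quat_mulDl : left_distributive quat_mul +%R.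
Proof. by move=> p q r; quat_ring. Qed.
Lemma quat_mulDr : right_distributive quat_mul +%R.
Proof. by move=> p q r; quat_ring. Qed.
Lemma quat_1neq0 : quat_one != 0.
Proof. by apply/eqP => /(congr1 qre)/eqP; rewrite /qre /= oner_eq0. Qed.

End quaternions.

HB.instance Definition _ (R : realType) :=
  GRing.Zmodule_isNzRing.Build (quat R)
    (@quat_mulA R) (@quat_mul1l R) (@quat_mul1r R)
    (@quat_mulDl R) (@quat_mulDr R) (@quat_1neq0 R).

Section quaternion_algebra.
Variable R : realType.
Implicit Types (a : R) (p q : quat R).

Lemma quat_mulE p q : p * q = quat_mul p q. Proof. by []. Qed.

Local Ltac quat_ring :=
  apply: quat_eqP; rewrite !quat_mulE /quat_mul /qre /qi /qj /qk /=
    /GRing.scale /=; ring.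

Lemma quat_scaleAl a p q : a *: (p * q) = (a *: p : quat R) * q.
Proof. by quat_ring. Qed.
Lemma quat_scaleAr a p q : a *: (p * q) = p * (a *: q : quat R).
Proof. by quat_ring. Qed.

End quaternion_algebra.

HB.instance Definition _ (R : realType) :=
  GRing.Lmodule_isLalgebra.Build R (quat R) (@quat_scaleAl R).
HB.instance Definition _ (R : realType) :=
  GRing.Lalgebra_isAlgebra.Build R (quat R) (@quat_scaleAr R).

(* H (x)_R C: the pair (F1, F2) stands for F1 + iota F2, with iota central. *)
Definition quatC (R : realType) : Type := (quat R * quat R)%type.

HB.instance Definition _ (R : realType) :=
  NormedModule.copy (quatC R) (quat R * quat R)%type.

Section complexified_quaternions.
Variable R : realType.
Implicit Types u v w : quatC R.

Definition quatC_one : quatC R := (1, 0).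
Definition quatC_mul u v : quatC R :=
  (u.1 * v.1 - u.2 * v.2, u.1 * v.2 + u.2 * v.1).

Lemma quatC_mulA : associative quatC_mul.
Proof.
move=> u v w; congr pair => /=;
  rewrite !(mulrBr, mulrBl, mulrDr, mulrDl) ?opprD !mulrA -!addrA;
  by congr (_ + _); rewrite [RHS]addrC addrA.
Qed.
Lemma quatC_mul1l : left_id quatC_one quatC_mul.
Proof. by case=> a b; rewrite /quatC_mul /= !mul1r !mul0r subr0 addr0. Qed.
Lemma quatC_mul1r : right_id quatC_one quatC_mul.
Proof. by case=> a b; rewrite /quatC_mul /= !mulr1 !mulr0 subr0 add0r. Qed.
Lemma quatC_mulDl : left_distributive quatC_mul +%R.
Proof.
move=> u v w; congr pair => /=.
  by rewrite !mulrDl opprD addrACA.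
by rewrite !mulrDl addrACA.
Qed.
Lemma quatC_mulDr : right_distributive quatC_mul +%R.
Proof.
move=> u v w; congr pair => /=.
  by rewrite !mulrDr opprD addrACA.
by rewrite !mulrDr addrACA.
Qed.
Lemma quatC_1neq0 : quatC_one != 0.
Proof. by apply/eqP => /(congr1 fst)/eqP; rewrite /= oner_eq0. Qed.

End complexified_quaternions.

HB.instance Definition _ (R : realType) :=
  GRing.Zmodule_isNzRing.Build (quatC R)
    (@quatC_mulA R) (@quatC_mul1l R) (@quatC_mul1r R)
    (@quatC_mulDl R) (@quatC_mulDr R) (@quatC_1neq0 R).

Section complexified_algebra.
Variable R : realType.
Implicit Types (a : R) (u v : quatC R).

Lemma quatC_mulE u v : u * v = quatC_mul u v. Proof. by []. Qed.

Lemma quatC_scaleAl a u v : a *: (u * v) = (a *: u : quatC R) * v.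
Proof.
by rewrite !quatC_mulE; congr pair => /=;
  rewrite ?(scalerDr, scalerN) !scalerAl.
Qed.
Lemma quatC_scaleAr a u v : a *: (u * v) = u * (a *: v : quatC R).
Proof.
by rewrite !quatC_mulE; congr pair => /=;
  rewrite ?(scalerDr, scalerN) !scalerAr.
Qed.

End complexified_algebra.

HB.instance Definition _ (R : realType) :=
  GRing.Lmodule_isLalgebra.Build R (quatC R) (@quatC_scaleAl R).
HB.instance Definition _ (R : realType) :=
  GRing.Lalgebra_isAlgebra.Build R (quatC R) (@quatC_scaleAr R).

Section slice_functions.
Variable R : realType.
Implicit Types (D : set R[i]) (F G : R[i] -> quatC R) (f g h : quat R -> quat R).
Implicit Types (J x lambda mu : quat R).

Definition iotaC : quatC R := (0, 1).
Definition quatC_conj (u : quatC R) : quatC R := (u.1, - u.2).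

Definition imag_units : set (quat R) := [set J | J ^+ 2 = -1].

Definition Omega D : set (quat R) :=
  [set x | exists a b : R, exists J : quat R,
     [/\ D (a +i* b), imag_units J & x = a%:A + b *: J]].

Definition axially_symmetric_domain D : Prop :=
  [/\ open D, (forall z, D z -> D (conjc z)), open (Omega D) &
      connected (Omega D)].

(* Functions on D, resp. on Omega D, are total functions of which only the
   values on D, resp. on Omega D, are relevant. *)
Definition stem_function D F : Prop := forall z, D z -> F (conjc z) = quatC_conj (F z).

Definition im_modulus x : R := Num.sqrt (qi x ^+ 2 + qj x ^+ 2 + qk x ^+ 2).
Definition im_dir x : quat R :=
  (im_modulus x)^-1 *: ((0, qi x, qj x, qk x) : quat R).

(* I(F), computed from the decomposition x = alpha + J beta with beta >= 0.
   For real x the direction im_dir x is 0 / 0 = 0, harmless since the F2 of a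
   stem function vanishes on the real axis.  By slice_funE every other
   decomposition of x gives the same value. *)
Definition slice_fun F : quat R -> quat R := fun x =>
  (F (qre x +i* im_modulus x)).1 + im_dir x * (F (qre x +i* im_modulus x)).2.

Definition dalpha F : R[i] -> quatC R :=
  fun z => derive1 (fun t : R => F (t +i* complex.Im z)) (complex.Re z).
Definition dbeta F : R[i] -> quatC R :=
  fun z => derive1 (fun t : R => F (complex.Re z +i* t)) (complex.Im z).

Definition classC1 D F : Prop := forall z, D z ->
  [/\ derivable (fun t : R => F (t +i* complex.Im z)) (complex.Re z) 1,
      derivable (fun t : R => F (complex.Re z +i* t)) (complex.Im z) 1,
      {for z, continuous (dalpha F)} &
      {for z, continuous (dbeta F)}].

Definition dz F : R[i] -> quatC R :=
  fun z => (2%:R^-1 : R) *: (dalpha F z - iotaC * dbeta F z).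
Definition dzbar F : R[i] -> quatC R :=
  fun z => (2%:R^-1 : R) *: (dalpha F z + iotaC * dbeta F z).

Definition holomorphic_stem D F : Prop :=
  [/\ stem_function D F, classC1 D F & forall z, D z -> dzbar F z = 0].

(* The stem function inducing f on Omega D; by stem_of_unique it is unique
   on D. *)
Definition stem_of D f : R[i] -> quatC R :=
  xget (fun=> 0) [set F | stem_function D F /\ {in Omega D, f =1 slice_fun F}].

Definition slice_regular D f : Prop :=
  exists2 F, holomorphic_stem D F & {in Omega D, f =1 slice_fun F}.

Definition slice_deriv D f : quat R -> quat R := slice_fun (dz (stem_of D f)).

Definition slice_constant D g : Prop :=
  slice_regular D g /\ {in Omega D, slice_deriv D g =1 fun=> 0}.

Definition slice_mul D f g : quat R -> quat R :=
  slice_fun (fun z => stem_of D f z * stem_of D g z).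

(* slice_D D lambda is the operator D_lambda on functions on Omega D; its
   last term is the pointwise right multiplication by lambda. *)
Definition slice_D D lambda f : quat R -> quat R :=
  fun x => slice_deriv D f x - f x * lambda.

Definition slice_exp lambda : quat R -> quat R := fun x =>
  \big[+%R/0]_(0 <= n <oo) ((n`!%:R^-1 : R) *: (x ^+ n * lambda ^+ n)).

Definition slice_g mu lambda : quat R -> quat R := fun x =>
  \big[+%R/0]_(1 <= n <oo) ((n`!%:R^-1 : R) *:
    (x ^+ n * \sum_(0 <= k < n) mu ^+ k * lambda ^+ (n - k - 1))).

Definition solution D mu lambda f : Prop :=
  slice_regular D f /\
  {in Omega D, slice_D D mu (slice_D D lambda f) =1 fun=> 0}.

Lemma imag_unitsP J : imag_units J <->
  qre J = 0 /\ qi J ^+ 2 + qj J ^+ 2 + qk J ^+ 2 = 1.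
Proof.
split.
  rewrite /imag_units /= expr2 quat_mulE => JJ.
  have := congr1 (@qre R) JJ; have := congr1 (@qi R) JJ.
  have := congr1 (@qj R) JJ; have := congr1 (@qk R) JJ.
  case: J {JJ} => [[[a b] c] d]; rewrite /qre /qi /qj /qk /= /qre /qi /qj /qk /=
    => hd hc hb ha.
  have a0 : a = 0.
    apply/eqP/negP => /negP a0.
    have h0 y : a * y + y * a = 0 -> y = 0.
      move=> hy; have /eqP : a * y = 0 by lra.
      by rewrite mulf_eq0 (negbTE a0) => /eqP.
    have b0 : b = 0 by apply: h0; lra.
    have c0 : c = 0 by apply: h0; lra.
    have d0 : d = 0 by apply: h0; lra.
    by move: ha; rewrite b0 c0 d0; nra.
  by split=> //; move: ha; rewrite a0; lra.
case: J => [[[a b] c] d]; rewrite /qre /qi /qj /qk /= => -[-> h].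
rewrite /imag_units /= expr2 quat_mulE.
by apply: quat_eqP; rewrite /qre /qi /qj /qk /= /qre /qi /qj /qk /=; lra.
Qed.

Lemma qre_slice (a b : R) J : imag_units J -> qre (a%:A + b *: J) = a.
Proof.
move=> /imag_unitsP[]; case: J => [[[j0 j1] j2] j3]; rewrite /qre /= => -> _.
by rewrite /GRing.scale /=; ring.
Qed.

Lemma im_slice (a b : R) J : imag_units J ->
  ((0, qi (a%:A + b *: J), qj (a%:A + b *: J), qk (a%:A + b *: J)) : quat R)
    = b *: J.
Proof.
move=> /imag_unitsP[]; case: J => [[[j0 j1] j2] j3]; rewrite /qre /= => -> _.
by apply: quat_eqP; rewrite /qre /qi /qj /qk /= /GRing.scale /=; ring.
Qed.

Lemma im_modulus_slice (a b : R) J : imag_units J ->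
  im_modulus (a%:A + b *: J) = `|b|.
Proof.
move=> SJ; have [J0 J1] := (imag_unitsP J).1 SJ; have := im_slice a b SJ.
set x := a%:A + b *: J => h.
have hi : qi x = b * qi J by have := congr1 (@qi R) h.
have hj : qj x = b * qj J by have := congr1 (@qj R) h.
have hk : qk x = b * qk J by have := congr1 (@qk R) h.
rewrite /im_modulus hi hj hk -sqrtr_sqr; congr Num.sqrt.
by rewrite !exprMn -!mulrDr J1 mulr1.
Qed.

Lemma stem_real D F (a : R) : stem_function D F -> D (a +i* 0) -> (F (a +i* 0)).2 = 0.
Proof.
move=> sF Da; have := sF _ Da; rewrite /= oppr0 => /(congr1 snd) /= h.
have : (2%:R : R) *: (F (a +i* 0)).2 = 0.
  by rewrite scaler_nat mulr2n {2}h subrr.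
by move=> /eqP; rewrite scaler_eq0 pnatr_eq0 /= => /eqP.
Qed.

Lemma slice_funE D F (a b : R) J : stem_function D F -> D (a +i* b) ->
  imag_units J ->
  slice_fun F (a%:A + b *: J) = (F (a +i* b)).1 + J * (F (a +i* b)).2.
Proof.
move=> sF Dab SJ.
rewrite /slice_fun /im_dir im_slice// im_modulus_slice// qre_slice//.
have [b0|b0|b0] := ltrgtP b 0.
- rewrite ltr0_norm//; have -> : a +i* (- b) = conjc (a +i* b) by [].
  rewrite sF//= scalerA invrN mulNr mulVf ?lt_eqF//.
  by rewrite scaleN1r mulrNN.
- by rewrite gtr0_norm// scalerA mulVf ?gt_eqF// scale1r.
- rewrite b0 in Dab *; rewrite normr0 (stem_real sF Dab).
  by rewrite !mulr0.
Qed.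

Lemma imag_units_nonempty : imag_units ((0, 1, 0, 0) : quat R).
Proof. by apply/imag_unitsP; rewrite /qre /qi /qj /qk /=; split=> //; ring. Qed.

Lemma stem_of_unique D f F : (forall z, D z -> D (conjc z)) ->
  stem_function D F -> {in Omega D, f =1 slice_fun F} -> {in D, stem_of D f =1 F}.
Proof.
move=> Dconj sF fF; rewrite /stem_of; case: xgetP => [G _ [sG fG]|/(_ F)[]//].
case=> a b; rewrite inE => Dab; pose J : quat R := (0, 1, 0, 0).
have SJ : imag_units J := imag_units_nonempty.
have inO (c : R) : D (a +i* c) -> a%:A + c *: J \in Omega D.
  by move=> Dac; rewrite inE; exists a, c, J.
have eqFG (c : R) : D (a +i* c) ->
    (G (a +i* c)).1 + J * (G (a +i* c)).2 =
    (F (a +i* c)).1 + J * (F (a +i* c)).2.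
  move=> Dac; rewrite -(slice_funE sG)// -(slice_funE sF)//.
  by rewrite -fG ?fF// inO.
have h1 := eqFG b Dab; have := eqFG (- b) (Dconj _ Dab).
have -> : a +i* (- b) = conjc (a +i* b) by [].
rewrite sF// sG//= !mulrN => h2.
set u := (G _).1 in h1 h2; set v := J * (G _).2 in h1 h2.
set u' := (F _).1 in h1 h2; set v' := J * (F _).2 in h1 h2.
have two0 (w w' : quat R) : w + w = w' + w' -> w = w'.
  move=> ww; have : (2%:R : R) *: w = (2%:R : R) *: w'.
    by rewrite !scaler_nat !mulr2n.
  by apply: scalerI; rewrite pnatr_eq0.
have hu : u = u'.
  apply: two0; transitivity ((u + v) + (u - v)); first by rewrite addrACA subrr addr0.
  by rewrite h1 h2 addrACA subrr addr0.
have hv : v = v' by move: h1; rewrite hu => /addrI.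
have {}hv : (G (a +i* b)).2 = (F (a +i* b)).2.
  have : - (J * v) = - (J * v') by rewrite hv.
  by rewrite /v /v' !mulrA -[J * J]expr2 SJ !mulN1r !opprK.
by rewrite [LHS]surjective_pairing [RHS]surjective_pairing -/u -/u' hu hv.
Qed.

End slice_functions.

(* Main.v *)
(** On stem functions, D_lambda is F |-> F' - F lambda, where F' is the
    derivative in the central variable z = alpha + iota beta.  The stem
    function E_lambda(z) = exp(z lambda) of exp_lambda satisfies
    E_lambda' = E_lambda lambda and has inverse E_{-lambda}.  Suppose
    D_lambda G = E_mu.  If P = D_lambda F satisfies D_mu P = 0, then
    H1 = P E_{-mu} has zero derivative, hence so has
    H2 = (F - H1 G) E_{-lambda}, and F = H1 G + H2 E_lambda.  Such a G is the
    stem function of g^{mu,lambda} in general,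
    (E_mu - E_lambda) (mu - lambda)^{-1} if lambda and mu are distinct and
    commute, and z E_lambda if lambda = mu.

    Applying D_mu to D_lambda F requires the derivative of a C1 holomorphic
    stem function to be C1 holomorphic again.  This is Cauchy's formula,
    applied to the four complex coordinates of F under H (x) C = C^4; it is
    proved by deforming the circle to a point, so that only differentiation
    under the integral sign is needed. *)
Require Import Defs.
From HB Require Import structures.
From mathcomp Require Import all_boot all_order all_algebra.
From mathcomp Require Import complex ring lra.
From mathcomp Require Import all_classical all_reals all_analysis.
Import Order.TTheory GRing.Theory Num.Theory.
Import numFieldNormedType.Exports ComplexField.Normc.
Local Open Scope classical_set_scope.
Local Open Scope ring_scope.
Local Open Scope complex_scope.
Set Implicit Arguments.
Unset Strict Implicit.
Unset Printing Implicit Defensive.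
Local Notation Re := complex.Re.
Local Notation Im := complex.Im.

(** * Complex differentiability *)

(** The parameters lambda and mu act on the right and the integration constants on the left, so the
    Leibniz rule in H (x) C never has to exchange factors. In the general case the only commutations
    of quaternions with exponentials are those of lambda with E_{-lambda} and of mu with E_{-mu};
    that lambda and mu commute is used where (mu - lambda)^{-1} has to pass lambda or an
    exponential. Working with stem functions is what makes this possible: there the slice product is
    pointwise and the variable is central, whereas the slice functions themselves are not multiplied
    pointwise. *)

Lemma is_derive_epsP (K : numFieldType) (V : normedModType K) (f : K -> V)
    (x : K) (d : V) :
  is_derive x 1 f d <->
  forall e, 0 < e -> exists2 k, 0 < k &
    forall h, `|h| < k -> `|f (x + h) - f x - h *: d| <= e * `|h|.
Proof.
have E h : h != 0 -> `|d - h^-1 *: (f (x + h) - f x)| =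
    `|f (x + h) - f x - h *: d| / `|h|.
  move=> h0; rewrite -normfV mulrC -normrZ distrC.
  by rewrite [in RHS]scalerBr scalerA mulVf// scale1r.
split.
  move=> [fx fd] e e0.
  have : h^-1 *: (f (h *: 1 + x) - f x) @[h --> 0^'] --> d.
    by rewrite -fd; apply: fx.
  move=> /cvgrPdist_le/(_ _ e0)/nbhs_ballP[k /= k0 kP].
  exists k => // h hk.
  have [->|h0] := eqVneq h 0.
    by rewrite addr0 subrr scale0r subrr !normr0 mulr0.
  have := kP h; rewrite /= /ball /= sub0r normrN => /(_ hk h0).
  by rewrite [h *: 1]mulr1 (addrC h) E// ler_pdivrMr ?normr_gt0.
move=> H.
have c : h^-1 *: (f (h *: 1 + x) - f x) @[h --> 0^'] --> d.
  apply/cvgrPdist_le => e e0; have [k k0 kP] := H e e0.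
  apply/nbhs_ballP; exists k => //= h; rewrite /ball /= sub0r normrN => hk h0.
  by rewrite [h *: 1]mulr1 (addrC h) E// ler_pdivrMr ?normr_gt0// kP.
split; first by apply/cvg_ex; exists d.
exact: cvg_lim c.
Qed.

Section complex_calculus.
Variable R : realType.
Local Notation C := R[i].
Implicit Types (f g : C -> C) (p q : R -> C) (z w a b : C) (t x : R).

(** The norm of [C] has its values in [C]; estimates are made with the real number [normc z], and
    this identity translates between the two. *)
Lemma normrcE z : `|z| = (normc z)%:C. Proof. by []. Qed.

Lemma normc_ge0 z : 0 <= normc z.
Proof. by case: z => a b; exact: sqrtr_ge0. Qed.

Lemma ler_normcD z w : normc (z + w) <= normc z + normc w.
Proof. exact: (@le_normcD R z w). Qed.

Lemma normc_opp z : normc (- z) = normc z.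
Proof. exact: (@normcN R z). Qed.

Lemma normc_distC z w : normc (z - w) = normc (w - z).
Proof. by rewrite -normc_opp opprB. Qed.

Lemma normc_RC x : normc x%:C = `|x|.
Proof. by rewrite /= expr0n /= addr0 sqrtr_sqr. Qed.

Lemma normc_Re z : `|Re z| <= normc z.
Proof. by rewrite -lecR; exact: normc_ge_Re. Qed.

Lemma normc_Im z : `|Im z| <= normc z.
Proof.
case: z => a b /=; rewrite -sqrtr_sqr ler_wsqrtr//.
by rewrite lerDr sqr_ge0.
Qed.

Lemma normc_le z : normc z <= `|Re z| + `|Im z|.
Proof.
rewrite {1}(complexE z) (le_trans (ler_normcD _ _))// normc_RC normcM normc_RC.
by rewrite {1}/normc /= expr0n /= add0r expr1n sqrtr1 mul1r.
Qed.

Lemma complex_gt0P (e : C) : 0 < e -> 0 < Re e /\ e = (Re e)%:C.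
Proof. by case: e => a b; rewrite ltcE /= => /andP[/eqP-> ->]. Qed.

Lemma ReM z w : Re (z * w) = Re z * Re w - Im z * Im w.
Proof. by case: z w => [? ?] [? ?]. Qed.

Lemma ImM z w : Im (z * w) = Re z * Im w + Im z * Re w.
Proof. by case: z w => [? ?] [? ?]. Qed.

Lemma ReD z w : Re (z + w) = Re z + Re w.
Proof. by case: z w => [? ?] [? ?]. Qed.

Lemma ImD z w : Im (z + w) = Im z + Im w.
Proof. by case: z w => [? ?] [? ?]. Qed.

Lemma ReN z : Re (- z) = - Re z.
Proof. by case: z. Qed.

Lemma ImN z : Im (- z) = - Im z.
Proof. by case: z. Qed.

Definition ReImE := (ReD, ImD, ReN, ImN, ReM, ImM).

Lemma complex_ext z w : Re z = Re w -> Im z = Im w -> z = w.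
Proof. by case: z w => [? ?] [? ?] /= -> ->. Qed.

Lemma cderiveP f z d :
  is_derive z 1 f d <->
  forall e : R, 0 < e -> exists2 k : R, 0 < k &
    forall h, normc h < k -> normc (f (z + h) - f z - d * h) <= e * normc h.
Proof.
split=> [/is_derive_epsP H e e0|H].
  have [|k k0 kP] := H e%:C; first by rewrite ltcR.
  have [k0' kE] := complex_gt0P k0.
  exists (Re k) => // h hk; have := kP h.
  by rewrite kE !normrcE -rmorphM lecR ltcR /GRing.scale /= (mulrC h); apply.
apply/is_derive_epsP => e /complex_gt0P[e0 ->].
have [k k0 kP] := H _ e0.
exists k%:C; first by rewrite ltcR.
by move=> h; rewrite !normrcE -rmorphM lecR ltcR /GRing.scale /= (mulrC h); exact: kP.
Qed.

Lemma ccontinuousP f z :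
  {for z, continuous f} <->
  forall e : R, 0 < e -> exists2 k : R, 0 < k &
    forall h, normc h < k -> normc (f (z + h) - f z) < e.
Proof.
split=> [/cvgrPdist_lt H e e0|H].
  have /H/nbhs_ballP[k /= k0 kP] : 0 < e%:C by rewrite ltcR.
  have [k0' kE] := complex_gt0P k0.
  exists (Re k) => // h hk; have := kP (z + h).
  rewrite /ball /= opprD addNKr normrN normrcE kE ltcR => /(_ hk).
  by rewrite normrcE normc_distC ltcR.
apply/(cvgrPdist_lt (FF := nbhs_filter z)) => e /complex_gt0P[e0 ->].
have [k k0 kP] := H _ e0.
apply/nbhs_ballP; exists k%:C; first by rewrite /= ltcR.
move=> w; rewrite /ball /= !normrcE !ltcR => wk.
by rewrite normc_distC; have := kP (w - z); rewrite [z + _]addrC subrK; apply; rewrite normc_distC.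
Qed.

Lemma open_normcP (D : set C) z : open D -> D z ->
  exists2 r : R, 0 < r & forall h, normc h < r -> D (z + h).
Proof.
rewrite openE => oD Dz; have /nbhs_ballP[k /= k0 kP] := oD _ Dz.
have [k0' kE] := complex_gt0P k0.
exists (Re k) => // h hk; apply: kP.
by rewrite /ball /= opprD addNKr normrN normrcE kE ltcR.
Qed.

(** [C] is a normed space over itself here, so [is_derive] does not apply to a map from [R] to [C];
    curves are differentiated by components. *)
Definition path_derive p t d :=
  is_derive t 1 (fun s => Re (p s)) (Re d) /\
  is_derive t 1 (fun s => Im (p s)) (Im d).

Lemma path_deriveP p t d :
  path_derive p t d <->
  forall e : R, 0 < e -> exists2 k : R, 0 < k &
    forall h : R, `|h| < k -> normc (p (t + h) - p t - d * h%:C) <= e * `|h|.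
Proof.
split=> [[/is_derive_epsP HR /is_derive_epsP HI] e e0|H].
  have e2 : 0 < e / 2 by rewrite divr_gt0.
  have [k k0 kP] := HR _ e2; have [l l0 lP] := HI _ e2.
  exists (Num.min k l); first by rewrite lt_min k0.
  move=> h; rewrite lt_min => /andP[hk hl].
  rewrite (le_trans (normc_le _))//.
  have -> : e * `|h| = e / 2 * `|h| + e / 2 * `|h| by field.
  rewrite lerD// ?ReImE /= mulr0.
    by rewrite subr0 mulrC; exact: kP.
  by rewrite add0r mulrC; exact: lP.
split; apply/is_derive_epsP => e /H[k k0 kP]; exists k => // h /kP;
  apply: le_trans.
  by have := normc_Re (p (t + h) - p t - d * h%:C); rewrite !ReImE /= mulr0 subr0 mulrC.
by have := normc_Im (p (t + h) - p t - d * h%:C); rewrite !ReImE /= mulr0 add0r mulrC.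
Qed.

Lemma path_derive_eq p t d d' : path_derive p t d -> d = d' -> path_derive p t d'.
Proof. by move=> + <-. Qed.

Lemma path_derive_cst a t : path_derive (fun=> a) t 0.
Proof. by split; exact: is_derive_cst. Qed.

Lemma path_derive_RC (u : R -> R) (t d : R) : is_derive t 1 u d ->
  path_derive (fun s => (u s)%:C) t d%:C.
Proof. by move=> ud; split => //=; exact: is_derive_cst. Qed.

Lemma path_deriveD p q t a b : path_derive p t a -> path_derive q t b ->
  path_derive (fun s => p s + q s) t (a + b).
Proof.
move=> [? ?] [? ?]; split.
  by under eq_fun do rewrite ReD; rewrite ReD; exact: is_deriveD.
by under eq_fun do rewrite ImD; rewrite ImD; exact: is_deriveD.
Qed.

Lemma path_deriveB p q t a b : path_derive p t a -> path_derive q t b ->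
  path_derive (fun s => p s - q s) t (a - b).
Proof.
move=> [? ?] [? ?]; split.
  by under eq_fun do rewrite ReD ReN; rewrite ReD ReN; exact: is_deriveB.
by under eq_fun do rewrite ImD ImN; rewrite ImD ImN; exact: is_deriveB.
Qed.

Lemma path_deriveM p q t a b : path_derive p t a -> path_derive q t b ->
  path_derive (fun s => p s * q s) t (a * q t + p t * b).
Proof.
move=> [? ?] [? ?]; split.
  under eq_fun do rewrite ReM; apply: is_derive_eq.
  by rewrite !ReImE /GRing.scale /=; ring.
under eq_fun do rewrite ImM; apply: is_derive_eq.
by rewrite !ReImE /GRing.scale /=; ring.
Qed.

Lemma path_deriveMl a p t b : path_derive p t b ->
  path_derive (fun s => a * p s) t (a * b).
Proof.
move=> pb; apply: path_derive_eq (path_deriveM (path_derive_cst a t) pb) _.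
by rewrite mul0r add0r.
Qed.

Lemma path_deriveMr a p t b : path_derive p t b ->
  path_derive (fun s => p s * a) t (b * a).
Proof.
move=> pb; apply: path_derive_eq (path_deriveM pb (path_derive_cst a t)) _.
by rewrite mulr0 addr0.
Qed.

Lemma path_derive_comp f p t a b : is_derive (p t) 1 f a -> path_derive p t b ->
  path_derive (fun s => f (p s)) t (a * b).
Proof.
move=> /cderiveP Hf /path_deriveP Hp; apply/path_deriveP => e e0.
(* Near [t] the increment of [p] is at most [N] times that of the parameter; the added 1 absorbs the
   linearization error of [p] and keeps both constants positive. The errors of [f] and of [p] get
   [e / 2] each. *)
pose N := normc b + 1; pose M := normc a + 1.
have N0 : 0 < N by rewrite ltr_wpDl// normc_ge0.
have M0 : 0 < M by rewrite ltr_wpDl// normc_ge0.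
have [|k k0 kP] := Hf (e / 2 / N); first by rewrite !divr_gt0.
have [|l l0 lP] := Hp (Num.min 1 (e / 2 / M)).
  by rewrite lt_min ltr01 !divr_gt0.
exists (Num.min l (k / N)); first by rewrite lt_min l0 divr_gt0.
move=> h; rewrite lt_min => /andP[hl]; rewrite ltr_pdivlMr// => hk.
have {}lP := lP _ hl; set n := p (t + h) - p t in lP.
have n1 : normc (n - b * h%:C) <= `|h|.
  by rewrite (le_trans lP)// ler_piMl// ge_min lexx.
have n2 : normc (n - b * h%:C) <= e / 2 / M * `|h|.
  by rewrite (le_trans lP)// ler_wpM2r// ge_min lexx orbT.
have nN : normc n <= N * `|h|.
  rewrite -[n](subrK (b * h%:C)) (le_trans (ler_normcD _ _))//.
  by rewrite normcM normc_RC /N mulrDl mul1r addrC lerD2l.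
have pn : p t + n = p (t + h) by rewrite /n [LHS]addrC subrK.
have nk : normc n < k by rewrite (le_lt_trans nN)// mulrC.
have kn := kP n nk; rewrite pn in kn.
have -> : f (p (t + h)) - f (p t) - a * b * h%:C =
    (f (p (t + h)) - f (p t) - a * n) + a * (n - b * h%:C) by ring.
rewrite (le_trans (ler_normcD _ _))// normcM.
have -> : e * `|h| = e / 2 / N * (N * `|h|) + M * (e / 2 / M * `|h|).
  by field; rewrite !gt_eqF.
apply: lerD.
  by rewrite (le_trans kn)// ler_wpM2l// ltW// !divr_gt0.
by rewrite ler_pM ?normc_ge0// /M lerDl.
Qed.

Lemma path_derive_line w a t : path_derive (fun s => w + s%:C * a) t a.
Proof.
apply: path_derive_eq (path_deriveD (path_derive_cst w t)
  (path_deriveMr a (path_derive_RC (is_derive_id t 1)))) _.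
by rewrite add0r mul1r.
Qed.

Lemma is_derive_continuous (u : R -> R) (t d : R) : is_derive t 1 u d ->
  {for t, continuous u}.
Proof.
by move=> [/derivable1_diffP ud _]; exact: differentiable_continuous.
Qed.

Lemma cderive_continuous f z d : is_derive z 1 f d -> {for z, continuous f}.
Proof.
by move=> [/derivable1_diffP ud _]; exact: differentiable_continuous.
Qed.

Lemma cderiveM f g z a b : is_derive z 1 f a -> is_derive z 1 g b ->
  is_derive z 1 (fun w => f w * g w) (a * g z + f z * b).
Proof.
by move=> fa gb; apply: is_derive_eq; rewrite /GRing.scale /=; ring.
Qed.

Lemma cderiveV f z a : f z != 0 -> is_derive z 1 f a ->
  is_derive z 1 (fun w => (f w)^-1) (- a / (f z) ^+ 2).
Proof.
move=> fz [fa <-]; split; first exact: derivableV.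
by rewrite deriveV// /GRing.scale /= mulrC mulrN mulNr.
Qed.

Lemma is_derive_mvt (u du : R -> R) (t0 t1 M : R) :
  (forall t, Num.min t0 t1 <= t <= Num.max t0 t1 ->
     is_derive t 1 u (du t) /\ `|du t| <= M) ->
  `|u t1 - u t0| <= M * `|t1 - t0|.
Proof.
wlog t01 : t0 t1 / t0 <= t1 => [H|] H'.
  have [|/ltW] := leP t0 t1; first by move/H; apply.
  move=> /H; rewrite distrC (distrC t1); apply=> t.
  by rewrite minC maxC; exact: H'.
rewrite (min_l t01) (max_r t01) in H'.
have [||c ct ->] := @MVT_segment _ u du t0 t1 t01.
- by move=> t tt; apply: (H' t _).1; move: tt; rewrite in_itv /= => /andP[/ltW-> /ltW->].
- apply: derivable_within_continuous => t; rewrite in_itv /= => tt.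
  by have [[]] := H' t tt.
- by rewrite normrM ler_wpM2r//; apply: (H' c _).2; rewrite in_itv in ct.
Qed.

(** The mean value theorem holds only for each component separately; adding the two bounds costs the
    factor 2. *)
Lemma path_derive_mvt p (dp : R -> C) (t0 t1 M : R) :
  (forall t, Num.min t0 t1 <= t <= Num.max t0 t1 ->
     path_derive p t (dp t) /\ normc (dp t) <= M) ->
  normc (p t1 - p t0) <= 2 * M * `|t1 - t0|.
Proof.
move=> H; rewrite (le_trans (normc_le _))// !ReImE -mulrA mulr_natl mulr2n lerD//.
  apply: (is_derive_mvt (u := fun t => Re (p t)) (du := fun t => Re (dp t))) => t /H[[? ?] ?].
  by split=> //; rewrite (le_trans (normc_Re _)).
apply: (is_derive_mvt (u := fun t => Im (p t)) (du := fun t => Im (dp t))) => t /H[[? ?] ?].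
by split=> //; rewrite (le_trans (normc_Im _)).
Qed.

Lemma cderive0_ball f (r : R) z : (forall w, normc w < r -> is_derive w 1 f 0) ->
  normc z < r -> f z = f 0.
Proof.
move=> f0 zr.
have : normc (f (0 + 1%:C * z) - f (0 + 0%:C * z)) <= 2 * 0 * `|1 - 0|.
  apply: (@path_derive_mvt (fun s => f (0 + s%:C * z)) (fun=> 0)) => t.
  rewrite min_l ?max_r// => /andP[t0 t1].
  split; last by rewrite normc0.
  apply: path_derive_eq (path_derive_comp (f0 _ _) (path_derive_line 0 z t)) _.
    by rewrite add0r normcM normc_RC ger0_norm// (le_lt_trans _ zr)// ler_piMl ?normc_ge0.
  by rewrite mul0r.
rewrite mulr0 mul0r mul1r mul0r !add0r => H.
apply/eqP; rewrite -subr_eq0; apply/eqP; apply: eq0_normc.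
by apply/eqP; rewrite eq_le H normc_ge0.
Qed.

Lemma cderive_unique f z a b : is_derive z 1 f a -> is_derive z 1 f b -> a = b.
Proof. by move=> [_ <-] [_ <-]. Qed.

Lemma cderive_near f g z d (r : R) : 0 < r ->
  (forall h, normc h < r -> f (z + h) = g (z + h)) ->
  is_derive z 1 f d -> is_derive z 1 g d.
Proof.
move=> r0 fg /cderiveP H; apply/cderiveP => e /H[k k0 kP].
exists (Num.min r k); first by rewrite lt_min r0.
move=> h; rewrite lt_min => /andP[hr hk].
by have := fg 0; rewrite addr0 normc0 -fg// => <-//; exact: kP.
Qed.

Lemma cderive_shift f z w d :
  is_derive w 1 (fun u => f (z + u)) d <-> is_derive (z + w) 1 f d.
Proof.
by split=> /cderiveP H; apply/cderiveP => e /H[k k0 kP]; exists k => // h /kP;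
  rewrite addrA.
Qed.

(** Kernels and power series are differentiated through this criterion: their first-order remainders
    have explicit quadratic bounds, so derivatives need not be interchanged with limits. *)
Lemma cderive_quadratic f z d (r M : R) : 0 < r ->
  (forall h, normc h < r -> normc (f (z + h) - f z - d * h) <= M * normc h ^+ 2) ->
  is_derive z 1 f d.
Proof.
move=> r0 H; apply/cderiveP => e e0.
have M0 : 0 < `|M| + 1 by rewrite ltr_wpDl.
exists (Num.min r (e / (`|M| + 1))); first by rewrite lt_min r0 divr_gt0.
move=> h; rewrite lt_min ltr_pdivlMr// => /andP[/H hr he].
rewrite (le_trans hr)// expr2 mulrA ler_wpM2r ?normc_ge0//.
rewrite (le_trans _ (ltW he))// [leRHS]mulrC ler_wpM2r ?normc_ge0//.
by rewrite (le_trans (ler_norm _))// lerDl.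
Qed.

(** A vertical step followed by a horizontal one leads from [z] to [z + h]. On each, the mean value
    inequality is applied to [f] minus the linear map of slope [df z]; the derivative of this
    difference is small because [df] is continuous at [z]. *)
Lemma cauchy_riemann_cderive (D : set C) f (df : C -> C) z : open D -> D z ->
  (forall w, D w -> path_derive (fun t => f (t +i* Im w)) (Re w) (df w)) ->
  (forall w, D w -> path_derive (fun t => f (Re w +i* t)) (Im w) ('i * df w)) ->
  {for z, continuous df} -> is_derive z 1 f (df z).
Proof.
move=> oD Dz fx fy /ccontinuousP cdf; apply/cderiveP => e e0.
have [r r0 rP] := open_normcP oD Dz.
(* The factor 2 of [path_derive_mvt] and the two steps together turn [e / 4] into [e]. *)
have [|k k0 kP] := cdf (e / 4); first by rewrite divr_gt0.
(* Half the radius, since the modulus is only bounded by the sum of the two components. *)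
pose m := Num.min r k / 2.
have m0 : 0 < m by rewrite divr_gt0// lt_min r0.
have mP (a b : R) : `|a| < m -> `|b| < m ->
    D (z + (a +i* b)) /\ normc (df (z + (a +i* b)) - df z) <= e / 4.
  move=> am bm; have : normc (a +i* b) < Num.min r k.
    rewrite (le_lt_trans (normc_le _))//= (lt_le_trans (ltrD am bm))//.
    by rewrite /m -splitr.
  by rewrite lt_min => /andP[/rP ? /kP/ltW].
case: z => x0 y0 in Dz cdf rP kP mP *.
exists m => // -[a b] hm.
have am : `|a| < m by rewrite (le_lt_trans _ hm)// (normc_Re (a +i* b)).
have bm : `|b| < m by rewrite (le_lt_trans _ hm)// (normc_Im (a +i* b)).
set d := df _.
have step1 : normc ((f ((x0 + a) +i* (y0 + b)) - (x0 + a)%:C * d) - (f (x0 +i* (y0 + b)) - x0%:C * d))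
    <= 2 * (e / 4) * `|x0 + a - x0|.
  apply: (@path_derive_mvt (fun t => f (t +i* (y0 + b)) - t%:C * d)
    (fun t => df (t +i* (y0 + b)) - d)) => t tt.
  have ta : `|t - x0| < m.
    rewrite (le_lt_trans _ am)//; case: (lerP 0 a) => a0.
      by rewrite min_l ?max_r in tt; [|lra|lra]; rewrite !ger0_norm; lra.
    by rewrite min_r ?max_l in tt; [|lra|lra]; rewrite !ler0_norm; lra.
  have := mP _ _ ta bm.
  have -> : x0 +i* y0 + ((t - x0) +i* b) = t +i* (y0 + b).
    by apply: complex_ext => //=; rewrite addrC subrK.
  move=> [Dt dt]; split=> //; apply: path_deriveB; first exact: (fx _ Dt).
  apply: path_derive_eq (path_deriveMr d (path_derive_RC (is_derive_id t 1))) _.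
  by rewrite mul1r.
have step2 : normc ((f (x0 +i* (y0 + b)) - (y0 + b)%:C * ('i * d)) - (f (x0 +i* y0) - y0%:C * ('i * d)))
    <= 2 * (e / 4) * `|y0 + b - y0|.
  apply: (@path_derive_mvt (fun t => f (x0 +i* t) - t%:C * ('i * d))
    (fun t => 'i * (df (x0 +i* t) - d))) => t tt.
  have ta : `|t - y0| < m.
    rewrite (le_lt_trans _ bm)//; case: (lerP 0 b) => a0.
      by rewrite min_l ?max_r in tt; [|lra|lra]; rewrite !ger0_norm; lra.
    by rewrite min_r ?max_l in tt; [|lra|lra]; rewrite !ler0_norm; lra.
  have /mP/(_ ta) : `|0 : R| < m by rewrite normr0.
  have -> : x0 +i* y0 + (0 +i* (t - y0)) = x0 +i* t.
    by apply: complex_ext; rewrite /= ?addr0// addrC subrK.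
  move=> [Dt dt]; split; last first.
    by rewrite normcM {1}/normc /= expr0n /= add0r expr1n sqrtr1 mul1r.
  rewrite mulrBr; apply: path_deriveB; first exact: (fy _ Dt).
  apply: path_derive_eq (path_deriveMr ('i * d) (path_derive_RC (is_derive_id t 1))) _.
  by rewrite mul1r.
have -> : x0 +i* y0 + (a +i* b) = ((x0 + a) +i* (y0 + b)) by [].
have -> : f ((x0 + a) +i* (y0 + b)) - f (x0 +i* y0) - d * (a +i* b) =
  ((f ((x0 + a) +i* (y0 + b)) - (x0 + a)%:C * d) - (f (x0 +i* (y0 + b)) - x0%:C * d))
 + ((f (x0 +i* (y0 + b)) - (y0 + b)%:C * ('i * d)) - (f (x0 +i* y0) - y0%:C * ('i * d))).
  by rewrite (_ : a +i* b = a%:C + 'i * b%:C) ?rmorphD; [ring | exact: complexE].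
rewrite (le_trans (ler_normcD _ _))// (le_trans (lerD step1 step2))//.
rewrite ![_ + _ - _]addrAC !subrr !add0r.
have ha := normc_Re (a +i* b); have hb := normc_Im (a +i* b).
rewrite /= in ha hb.
have -> : e * normc (a +i* b) = 2 * (e / 4) * normc (a +i* b) + 2 * (e / 4) * normc (a +i* b) by field.
by rewrite lerD// ler_wpM2l// mulr_ge0// divr_ge0// ltW.
Qed.

End complex_calculus.

(** * Integration over a period *)

Section integral_calculus.
Variable R : realType.
Local Notation C := R[i].
Local Notation mu := (@lebesgue_measure R).
Local Notation T := (pi *+ 2 : R).
Implicit Types (f g : C -> C) (p q : R -> C) (z w a b : C) (t x : R).

Definition path_continuous p :=
  continuous (fun s => Re (p s)) /\ continuous (fun s => Im (p s)).

Lemma path_derive_continuous p (dp : R -> C) :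
  (forall t, path_derive p t (dp t)) -> path_continuous p.
Proof.
by move=> H; split=> t; have [? ?] := H t; apply: is_derive_continuous.
Qed.

Lemma path_continuousB p q : path_continuous p -> path_continuous q ->
  path_continuous (fun s => p s - q s).
Proof.
move=> [p1 p2] [q1 q2]; split=> t.
  by under eq_fun do rewrite !ReImE; apply: cvgB; [exact: p1|exact: q1].
by under eq_fun do rewrite !ReImE; apply: cvgB; [exact: p2|exact: q2].
Qed.

Lemma path_continuousM p q : path_continuous p -> path_continuous q ->
  path_continuous (fun s => p s * q s).
Proof.
move=> [p1 p2] [q1 q2]; split=> t.
  under eq_fun do rewrite !ReImE; apply: cvgB.
    by apply: cvgM; [exact: p1|exact: q1].
  by apply: cvgM; [exact: p2|exact: q2].
under eq_fun do rewrite !ReImE; apply: cvgD.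
  by apply: cvgM; [exact: p1|exact: q2].
by apply: cvgM; [exact: p2|exact: q1].
Qed.

Lemma path_continuous_cst a : path_continuous (fun=> a).
Proof. by split=> t; exact: cvg_cst. Qed.

Lemma path_continuousP p : path_continuous p <->
  forall t (e : R), 0 < e -> exists2 k : R, 0 < k &
    forall h : R, `|h| < k -> normc (p (t + h) - p t) < e.
Proof.
split=> [[pR pI] t e e0|H].
  have e2 : 0 < e / 2 by rewrite divr_gt0.
  have /cvgrPdist_lt/(_ _ e2)/nbhs_ballP[k /= k0 kP] := pR t.
  have /cvgrPdist_lt/(_ _ e2)/nbhs_ballP[l /= l0 lP] := pI t.
  exists (Num.min k l); first by rewrite lt_min k0.
  move=> h; rewrite lt_min => /andP[hk hl].
  rewrite (le_lt_trans (normc_le _))// !ReImE (splitr e) ltrD//.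
    by rewrite distrC; apply: kP; rewrite /ball /= opprD addNKr normrN.
  by rewrite distrC; apply: lP; rewrite /ball /= opprD addNKr normrN.
split=> t; apply/cvgrPdist_lt => e e0; have [k k0 kP] := H t e e0;
  apply/nbhs_ballP; exists k => // s; rewrite /ball /= => tsk;
  have := kP (s - t); rewrite [t + _]addrC subrK distrC => /(_ tsk);
  apply: le_lt_trans; rewrite distrC.
  by have := normc_Re (p s - p t); rewrite !ReImE.
by have := normc_Im (p s - p t); rewrite !ReImE.
Qed.

Lemma path_continuous_comp f p : path_continuous p ->
  (forall t, {for p t, continuous f}) -> path_continuous (fun s => f (p s)).
Proof.
move=> /path_continuousP cp cf; apply/path_continuousP => t e e0.
have /ccontinuousP/(_ _ e0)[k k0 kP] := cf t.
have [l l0 lP] := cp t _ k0; exists l => // h /lP/kP.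
by rewrite [p t + _]addrC subrK.
Qed.

Lemma itv_integrable (u : R -> R) : continuous u ->
  mu.-integrable `[0, T] (EFin \o u).
Proof.
move=> cu; apply: continuous_compact_integrable; first exact: segment_compact.
exact: continuous_subspaceT.
Qed.

(** An integral over the parameter interval, without a factor dz. On a circle about 0 one has dz = i
    z dt, so Cauchy's formula will carry an extra factor z and the constant 1 / (2 pi). *)
Definition circ_int p : C :=
  (\int[mu]_(x in `[0, T]) Re (p x)) +i* (\int[mu]_(x in `[0, T]) Im (p x)).

Lemma circ_intB p q : path_continuous p -> path_continuous q ->
  circ_int (fun s => p s - q s) = circ_int p - circ_int q.
Proof.
move=> [p1 p2] [q1 q2]; apply: complex_ext; rewrite !ReImE /=.
  by under eq_Rintegral do rewrite !ReImE; rewrite RintegralB//; exact: itv_integrable.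
by under eq_Rintegral do rewrite !ReImE; rewrite RintegralB//; exact: itv_integrable.
Qed.

Lemma circ_intZ a p : path_continuous p ->
  circ_int (fun s => a * p s) = a * circ_int p.
Proof.
move=> [p1 p2]; have c (k : R) (u : R -> R) : continuous u -> continuous (fun s => k * u s).
  by move=> cu t; apply: cvgM; [exact: cvg_cst|exact: cu].
apply: complex_ext; rewrite !ReImE /=; under eq_Rintegral do rewrite !ReImE.
  by rewrite RintegralB ?RintegralZl//; apply: itv_integrable => //; apply: c.
by rewrite RintegralD ?RintegralZl//; apply: itv_integrable => //; apply: c.
Qed.

Lemma itv_measure : fine (mu `[0, T]) = T.
Proof.
by rewrite lebesgue_measure_itv /= lte_fin mulrn_wgt0 ?pi_gt0// sube0.
Qed.

Lemma twopi_gt0 : 0 < T.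
Proof. by rewrite mulrn_wgt0 ?pi_gt0. Qed.

Lemma itv_Rintegral_bound (u : R -> R) (M : R) : continuous u ->
  (forall t, 0 <= t <= T -> `|u t| <= M) ->
  `|\int[mu]_(x in `[0, T]) u x| <= M * T.
Proof.
move=> cu uM; have cnu : continuous (fun s => `|u s|).
  by move=> t; apply: cvg_norm; exact: cu.
rewrite (le_trans (le_normr_Rintegral _ (itv_integrable cu)))//.
have -> : M * T = \int[mu]_(_ in `[0, T]) M.
  by rewrite Rintegral_cst// itv_measure.
apply: le_Rintegral => //; first exact: itv_integrable.
by apply: itv_integrable => ?; exact: cvg_cst.
Qed.

Lemma circ_int_bound p (M : R) : path_continuous p ->
  (forall t, 0 <= t <= T -> normc (p t) <= M) ->
  normc (circ_int p) <= 2 * (M * T).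
Proof.
move=> [p1 p2] pM; rewrite (le_trans (normc_le _))// mulr_natl mulr2n lerD//.
  by apply: itv_Rintegral_bound => // t /pM; apply: le_trans (normc_Re _).
by apply: itv_Rintegral_bound => // t /pM; apply: le_trans (normc_Im _).
Qed.

Lemma itv_Rintegral_derive (v u : R -> R) : continuous u ->
  (forall t, is_derive t 1 v (u t)) ->
  \int[mu]_(x in `[0, T]) u x = v T - v 0.
Proof.
move=> cu vu; rewrite /Rintegral (continuous_FTC2 (F := v)) ?twopi_gt0//.
- exact: continuous_subspaceT.
- split.
  + by move=> t _; have [] := vu t.
  + by apply: cvg_at_right_filter; exact: (is_derive_continuous (vu 0)).
  + by apply: cvg_at_left_filter; exact: (is_derive_continuous (vu T)).
- by move=> t _; rewrite derive1E; have [] := vu t.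
Qed.

Lemma circ_int_derive p q : path_continuous q ->
  (forall t, path_derive p t (q t)) -> p 0 = p T -> circ_int q = 0.
Proof.
move=> [q1 q2] pq p0T; apply: complex_ext => /=.
  by rewrite (itv_Rintegral_derive q1 (fun t => (pq t).1)) p0T subrr.
by rewrite (itv_Rintegral_derive q2 (fun t => (pq t).2)) p0T subrr.
Qed.

Lemma itv_Rintegral_under (F dF : R -> R -> R) (u v t0 M : R) :
  (forall t, t \in `]u, v[ -> continuous (F t)) ->
  (forall t s, t \in `]u, v[ -> is_derive t 1 (F^~ s) (dF t s)) ->
  (forall t s, t \in `]u, v[ -> `|dF t s| <= M) -> t0 \in `]u, v[ ->
  is_derive t0 1 (fun t => \int[mu]_(x in `[0, T]) F t x)
    (\int[mu]_(x in `[0, T]) dF t0 x).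
Proof.
move=> cF FdF dM t0I.
have der t s : t \in `]u, v[ -> derive1 (F^~ s) t = dF t s.
  by move=> tI; rewrite derive1E; have [] := FdF t s tI.
have M0 : 0 <= M by rewrite (le_trans _ (dM _ 0 t0I)).
have mI : measurable [set` `[0, T]] by exact: measurable_itv.
have h1 : forall t, [set` `]u, v[] t -> mu.-integrable `[0, T] (EFin \o F t).
  by move=> t tI; apply: itv_integrable; exact: cF.
have h2 : forall t s, [set` `]u, v[] t -> [set` `[0, T]] s -> derivable (F^~ s) t 1.
  by move=> t s tI _; have [] := FdF t s tI.
have h3 : mu.-integrable `[0, T] (EFin \o (fun=> M)).
  by apply: itv_integrable => ?; exact: cvg_cst.
have h4 : forall t s, [set` `]u, v[] t -> [set` `[0, T]] s -> `|partial1of2 F t s| <= M.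
  by move=> t s tI _; rewrite /partial1of2 der//; exact: dM.
split; first exact: (@derivable_under_integral R _ (measurableTypeR R) mu F _ mI _ _ _ t0I h1 h2 _ (fun=> M0) h3 h4).
rewrite -derive1E (@differentiation_under_integral R _ (measurableTypeR R) mu F _ mI _ _ _ t0I h1 h2 _ (fun=> M0) h3 h4).
by apply: eq_Rintegral => s _; rewrite /partial1of2 der.
Qed.

Lemma circ_int_under (F dF : R -> R -> C) (u v t0 M : R) :
  (forall t, t \in `]u, v[ -> path_continuous (F t)) ->
  (forall t s, t \in `]u, v[ -> path_derive (F^~ s) t (dF t s)) ->
  (forall t s, t \in `]u, v[ -> normc (dF t s) <= M) -> t0 \in `]u, v[ ->
  path_derive (fun t => circ_int (F t)) t0 (circ_int (dF t0)).
Proof.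
move=> cF FdF dM t0I; split; rewrite /circ_int /=.
  apply: (itv_Rintegral_under (F := fun t s => Re (F t s))
    (dF := fun t s => Re (dF t s)) (u := u) (v := v) (M := M)) => //.
  - by move=> t /cF[].
  - by move=> t s /FdF - /(_ s)[].
  - by move=> t s tI; rewrite (le_trans (normc_Re _))// dM.
apply: (itv_Rintegral_under (F := fun t s => Im (F t s))
    (dF := fun t s => Im (dF t s)) (u := u) (v := v) (M := M)) => //.
- by move=> t /cF[].
- by move=> t s /FdF - /(_ s)[].
- by move=> t s tI; rewrite (le_trans (normc_Im _))// dM.
Qed.

End integral_calculus.

(** * Cauchy's formula and the regularity of derivatives *)

Section cauchy_formula.
Variable R : realType.
Local Notation C := R[i].
Local Notation T := (pi *+ 2 : R).
Implicit Types (f g : C -> C) (p q : R -> C) (z w a b h : C) (t x : R).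

Definition circle (r t : R) : C := r%:C * (cos t +i* sin t).

Lemma circle_derive r t : path_derive (circle r) t ('i * circle r t).
Proof.
rewrite /circle mulrCA; apply: path_deriveMl; split => /=; apply: is_derive_eq;
  ring.
Qed.

Lemma circle_continuous r : path_continuous (circle r).
Proof. exact: path_derive_continuous (circle_derive r). Qed.

Lemma circle_norm (r t : R) : 0 <= r -> normc (circle r t) = r.
Proof.
by move=> r0; rewrite normcM normc_RC /= cos2Dsin2 sqrtr1 mulr1 ger0_norm.
Qed.

Lemma circle_period r : circle r 0 = circle r T.
Proof. by rewrite /circle cos0 sin0 cos2pi sin2pi. Qed.

Lemma circle_sub_norm (r t : R) w : 0 < r -> normc w < r / 2 ->
  r / 2 <= normc (circle r t - w).
Proof.
move=> r0 wr; have := ler_normcD (circle r t - w) w.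
rewrite subrK (circle_norm _ (ltW r0))// => H; lra.
Qed.

Lemma circle_sub_neq0 (r t : R) w : 0 < r -> normc w < r / 2 ->
  circle r t - w != 0.
Proof.
move=> r0 /(circle_sub_norm t r0) H; apply/eqP => E; move: H.
by rewrite E normc0 leNgt divr_gt0.
Qed.

Definition resolvent (r : R) w t : C := (circle r t - w)^-1.

Lemma resolvent_derive (r t : R) w : 0 < r -> normc w < r / 2 ->
  path_derive (resolvent r w) t (- ('i * circle r t) * resolvent r w t ^+ 2).
Proof.
move=> r0 wr; have c0 := circle_sub_neq0 t r0 wr.
have d : path_derive (fun s => circle r s - w) t ('i * circle r t).
  by have := path_deriveB (circle_derive r t) (path_derive_cst w t); rewrite subr0.
apply: path_derive_eq (path_derive_comp (f := fun z => z^-1) _ d) _.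
  exact: (cderiveV (f := id) (a := 1)).
by rewrite /resolvent exprVn; field.
Qed.

Lemma resolvent_continuous (r : R) w : 0 < r -> normc w < r / 2 ->
  path_continuous (resolvent r w).
Proof.
by move=> r0 wr; apply: path_derive_continuous => t; exact: resolvent_derive.
Qed.

Lemma resolvent_norm (r t : R) w : 0 < r -> normc w < r / 2 ->
  normc (resolvent r w t) <= 2 / r.
Proof.
move=> r0 wr; rewrite normcV -[2 / r]invf_div lef_pV2 ?posrE ?divr_gt0//.
  exact: circle_sub_norm.
by rewrite (lt_le_trans _ (circle_sub_norm t r0 wr))// divr_gt0.
Qed.

(** The resolvent identity, from which all remainder estimates for the kernels follow. *)
Lemma resolvent_diff (r t : R) w h : 0 < r -> normc w < r / 2 ->
  normc (w + h) < r / 2 ->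
  resolvent r (w + h) t = resolvent r w t + h * resolvent r (w + h) t * resolvent r w t.
Proof.
move=> r0 wr whr; rewrite /resolvent.
by field; rewrite !circle_sub_neq0.
Qed.

Section kernel.
Variables (a : R -> C) (r A : R).
Hypotheses (ca : path_continuous a) (aA : forall t, normc (a t) <= A) (r0 : 0 < r).

(** For n = 1 this is the Cauchy integral of the density [a]; higher n give its derivatives up to a
    factorial. It is studied for [normc w < r / 2], where the resolvent is at most [2 / r]. *)
Definition kernel n w := circ_int (fun t => a t * resolvent r w t ^+ n).

Lemma kernel_continuous n w : normc w < r / 2 ->
  path_continuous (fun t => a t * resolvent r w t ^+ n).
Proof.
move=> wr; apply: path_continuousM => //; elim: n => [|n IH].
  by under eq_fun do rewrite expr0; exact: path_continuous_cst.
under eq_fun do rewrite exprS.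
by apply: path_continuousM => //; exact: resolvent_continuous.
Qed.

Lemma small_shift w : normc w < r / 2 -> exists2 k : R, 0 < k &
  forall h, normc h < k -> normc (w + h) < r / 2.
Proof.
move=> wr; exists (r / 2 - normc w); first by rewrite subr_gt0.
by move=> h hk; rewrite (le_lt_trans (ler_normcD _ _))// addrC -ltrBrDr.
Qed.

(** A second-order estimate of the integrand that is uniform in [t] survives integration; this takes
    the place of differentiating under the integral sign in the complex parameter. *)
Lemma kernel_derive_of n m (c : C) w (M : R) : normc w < r / 2 ->
  (forall h t, normc (w + h) < r / 2 ->
     normc (resolvent r (w + h) t ^+ n - resolvent r w t ^+ n - c * h * resolvent r w t ^+ m)
       <= M * normc h ^+ 2) ->
  is_derive w 1 (kernel n) (c * kernel m w).
Proof.
move=> wr H; have [k k0 kP] := small_shift wr.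
apply: (cderive_quadratic (M := 2 * (A * M * T)) k0) => h /kP whr.
have e : kernel n (w + h) - kernel n w - c * kernel m w * h =
  circ_int (fun t => a t * resolvent r (w + h) t ^+ n - a t * resolvent r w t ^+ n
     - (c * h) * (a t * resolvent r w t ^+ m)).
  rewrite circ_intB; last 2 first.
  - by apply: path_continuousB; exact: kernel_continuous.
  - by apply: path_continuousM (kernel_continuous _ wr); exact: path_continuous_cst.
  rewrite circ_intB; [|exact: kernel_continuous..].
  by rewrite circ_intZ; [rewrite mulrAC|exact: kernel_continuous].
rewrite e -mulrA [2 * _]mulrA.
rewrite (le_trans (circ_int_bound (M := A * (M * normc h ^+ 2)) _ _))//.
- apply: path_continuousB; last first.
    by apply: path_continuousM (kernel_continuous _ wr); exact: path_continuous_cst.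
  by apply: path_continuousB; exact: kernel_continuous.
- move=> t _; rewrite mulrCA -!mulrBr normcM.
  by rewrite ler_pM ?normc_ge0// H.
- by rewrite le_eqVlt; apply/orP; left; apply/eqP; ring.
Qed.

(** Three such derivatives are needed: [kernel 1] represents a function, [kernel 2] and [kernel 3]
    its first two derivatives up to constants, and the differentiability of [kernel 3] makes the
    second derivative continuous. *)
Lemma kernel1_derive w : normc w < r / 2 -> is_derive w 1 (kernel 1) (kernel 2 w).
Proof.
move=> wr; rewrite -[kernel 2 w]mul1r.
apply: (kernel_derive_of (M := (2 / r) ^+ 3)) => // h t whr.
set u := resolvent r w t; set v := resolvent r (w + h) t.
have vE : v = u + h * v * u by exact: resolvent_diff.
have -> : v ^+ 1 - u ^+ 1 - 1 * h * u ^+ 2 = h ^+ 2 * (v * u ^+ 2).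
  by rewrite !expr1 {1}vE {1}vE; ring.
rewrite normcM mulrC !expr2 !normcM ler_wpM2r ?mulr_ge0 ?normc_ge0//.
rewrite exprS expr2 ler_pM ?mulr_ge0 ?normc_ge0 ?resolvent_norm//.
by rewrite ler_pM ?normc_ge0 ?resolvent_norm.
Qed.

Lemma kernel2_derive w : normc w < r / 2 -> is_derive w 1 (kernel 2) (2 * kernel 3 w).
Proof.
move=> wr.
apply: (kernel_derive_of (M := 3 * (2 / r) ^+ 4)) => // h t whr.
set u := resolvent r w t; set v := resolvent r (w + h) t.
have vE : v - u = h * v * u by rewrite /v {1}(resolvent_diff t r0 wr whr) addrC addKr.
(* Each occurrence of [v - u] releases one factor [h]: one comes from the difference of squares, the
   other from what is left after subtracting the linear term. The cofactor has three terms, whence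
   the 3 in the bound. *)
have -> : v ^+ 2 - u ^+ 2 - 2 * h * u ^+ 3 = h ^+ 2 * (v * u ^+ 2 * (v + (u + u))).
  have -> : v ^+ 2 - u ^+ 2 - 2 * h * u ^+ 3 = (v - u) * (v + u) - 2 * h * u ^+ 3 by ring.
  rewrite vE.
  have -> : h * v * u * (v + u) - 2 * h * u ^+ 3 = h * u * (v - u) * (v + (u + u)) by ring.
  by rewrite vE; ring.
have nu : normc u <= 2 / r by exact: resolvent_norm.
have nv : normc v <= 2 / r by exact: resolvent_norm.
have hh : normc (h ^+ 2) = normc h ^+ 2 by rewrite !expr2 normcM.
rewrite normcM mulrC hh ler_wpM2r ?sqr_ge0//.
rewrite !normcM.
have -> : 3 * (2 / r) ^+ 4 = 2 / r * (2 / r * (2 / r)) * (3 * (2 / r)) by ring.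
rewrite ler_pM ?mulr_ge0 ?normc_ge0//.
  by rewrite ler_pM ?mulr_ge0 ?normc_ge0// ler_pM ?normc_ge0.
rewrite (le_trans (ler_normcD _ _))//.
have := ler_normcD u u; lra.
Qed.

Lemma kernel3_derive w : normc w < r / 2 -> is_derive w 1 (kernel 3) (3 * kernel 4 w).
Proof.
move=> wr.
apply: (kernel_derive_of (M := 6 * (2 / r) ^+ 5)) => // h t whr.
set u := resolvent r w t; set v := resolvent r (w + h) t.
have vE : v - u = h * v * u by rewrite /v {1}(resolvent_diff t r0 wr whr) addrC addKr.
have -> : v ^+ 3 - u ^+ 3 - 3 * h * u ^+ 4 =
    h ^+ 2 * (v * u ^+ 2 * (v * v + (u * v + u * v) + (u * u + u * u + u * u))).
  have -> : v ^+ 3 - u ^+ 3 - 3 * h * u ^+ 4 =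
      (v - u) * (v * v + u * v + u * u) - 3 * h * u ^+ 4 by ring.
  rewrite vE.
  have -> : h * v * u * (v * v + u * v + u * u) - 3 * h * u ^+ 4 =
      h * u * (v - u) * (v * v + (u * v + u * v) + (u * u + u * u + u * u)) by ring.
  by rewrite vE; ring.
have nu : normc u <= 2 / r by exact: resolvent_norm.
have nv : normc v <= 2 / r by exact: resolvent_norm.
have hh : normc (h ^+ 2) = normc h ^+ 2 by rewrite !expr2 normcM.
rewrite normcM mulrC hh ler_wpM2r ?sqr_ge0//.
rewrite normcM normcM.
(* Six counts, with multiplicity, the terms of [v * v + 2 * (u * v) + 3 * (u * u)]. *)
have -> : 6 * (2 / r) ^+ 5 = 2 / r * (2 / r * (2 / r)) * (6 * (2 / r * (2 / r))) by ring.
have uu : normc (u * u) <= 2 / r * (2 / r) by rewrite normcM ler_pM ?normc_ge0.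
have uv : normc (u * v) <= 2 / r * (2 / r) by rewrite normcM ler_pM ?normc_ge0.
have vv : normc (v * v) <= 2 / r * (2 / r) by rewrite normcM ler_pM ?normc_ge0.
rewrite ler_pM ?mulr_ge0 ?normc_ge0//.
  by rewrite ler_pM ?mulr_ge0 ?normc_ge0.
have n3 := ler_normcD (v * v + (u * v + u * v)) (u * u + u * u + u * u).
have n4 := ler_normcD (v * v) (u * v + u * v).
have n5 := ler_normcD (u * v) (u * v).
have n6 := ler_normcD (u * u + u * u) (u * u).
have n7 := ler_normcD (u * u) (u * u).
lra.
Qed.

End kernel.

(** The winding number of the circle. Its derivative in [w] is the integral of a derivative along a
    closed curve, so it does not depend on [w], and at [w = 0] the integrand is 1. *)
Lemma kernel_circle (r : R) w : 0 < r -> normc w < r / 2 ->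
  kernel (circle r) r 1 w = T%:C.
Proof.
move=> r0 wr.
have cA t : normc (circle r t) <= r by rewrite circle_norm// ltW.
rewrite (@cderive0_ball _ _ (r / 2) _ _ wr); last first.
  move=> z zr; have := kernel1_derive (circle_continuous r) cA r0 zr.
  suff -> : kernel (circle r) r 2 z = 0 by [].
  apply: (circ_int_derive (p := fun t => 'i * resolvent r z t)).
  - exact (kernel_continuous (circle_continuous r) r0 2 zr).
  - move=> t; apply: path_derive_eq (path_deriveMl _ (resolvent_derive t r0 zr)) _.
    have -> : 'i * (- ('i * circle r t) * resolvent r z t ^+ 2) =
        - 'i ^+ 2 * (circle r t * resolvent r z t ^+ 2) by ring.
    by rewrite sqr_i opprK mul1r.
  - by rewrite /resolvent circle_period.
have z0 : normc (0 : C) < r / 2 by rewrite normc0 divr_gt0.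
rewrite /kernel.
under eq_fun do rewrite expr1 /resolvent subr0.
have -> : (fun t => circle r t * (circle r t)^-1) = fun=> 1.
  by apply/funext => t; rewrite mulfV//; have := circle_sub_neq0 t r0 z0; rewrite subr0.
rewrite /circ_int /= !Rintegral_cst// itv_measure; apply: complex_ext => /=.
  by rewrite mul1r.
by rewrite mul0r.
Qed.

Section ball.
Variables (f f' : C -> C) (r M : R).
Hypotheses (r0 : 0 < r)
  (fd : forall z, normc z < 2 * r -> is_derive z 1 f (f' z))
  (f'c : forall z, normc z < 2 * r -> {for z, continuous f'})
  (fM : forall z, normc z < 2 * r -> normc (f z) <= M)
  (f'M : forall z, normc z < 2 * r -> normc (f' z) <= M).

(* The integral over theta of f (w + t (c - w)) * c / (c - w), c the circle,
   does not depend on t: its t-derivative is the integral of a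
   theta-derivative. *)
Lemma cauchy_formula w : normc w < r / 4 ->
  f w = (T%:C)^-1 * kernel (fun t => f (circle r t) * circle r t) r 1 w.
Proof.
move=> wr; have wr2 : normc w < r / 2 by have := r0; lra.
have T0 : (T%:C : C) != 0 by rewrite eq_complex /= gt_eqF ?twopi_gt0.
apply: (mulfI T0); rewrite mulrA mulfV// mul1r.
pose s t x := w + t%:C * (circle r x - w).
pose F t x := f (s t x) * (circle r x * resolvent r w x).
pose dF t x := f' (s t x) * circle r x.
(* Differentiation under the integral wants an open interval around [0, 1]. With the margin 1/4 and
   [normc w < r / 4], the point [s t x] has modulus at most 25/16 of [r], within the disc of radius
   [2 * r]. *)
have sr t x : t \in `](-(1/4)), (5/4)[ -> normc (s t x) < 2 * r.
  rewrite in_itv /= => tI; rewrite /s.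
  have -> : w + t%:C * (circle r x - w) = (1 - t%:C) * w + t%:C * circle r x by ring.
  rewrite (le_lt_trans (ler_normcD _ _))//.
  rewrite [normc (_ * w)]normcM [normc (t%:C * _)]normcM (circle_norm _ (ltW r0)).
  rewrite -(rmorph1 (real_complex R)) -rmorphB !normc_RC.
  have h1 : `|1 - t| <= 5 / 4 by rewrite ler_norml; have := r0; lra.
  have h2 : `|t| <= 5 / 4 by rewrite ler_norml; have := r0; lra.
  have := ler_pM (normr_ge0 _) (normc_ge0 _) h1 (ltW wr).
  have := ler_wpM2r (ltW r0) h2; have := r0; lra.
have sd t x : path_derive (s t) x (t%:C * ('i * circle r x)).
  apply: path_derive_eq (path_deriveD (path_derive_cst w x)
    (path_deriveMl _ (path_deriveB (circle_derive r x) (path_derive_cst w x)))) _.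
  by rewrite add0r subr0.
have sc t : path_continuous (s t) by exact: path_derive_continuous (sd t).
have Fc t : t \in `](-(1/4)), (5/4)[ -> path_continuous (F t).
  move=> tI; apply: path_continuousM.
    apply: path_derive_continuous => x.
    exact: (path_derive_comp (fd (sr _ _ tI)) (sd t x)).
  by apply: path_continuousM; [exact: circle_continuous|exact: resolvent_continuous].
have dFc t : t \in `](-(1/4)), (5/4)[ -> path_continuous (dF t).
  move=> tI; apply: path_continuousM (circle_continuous r).
  by apply: path_continuous_comp => // x; exact: f'c (sr _ _ tI).
have Fd t x : t \in `](-(1/4)), (5/4)[ -> path_derive (F^~ x) t (dF t x).
  move=> tI; have sl : path_derive (s^~ x) t (circle r x - w).
    exact: path_derive_line.
  have := path_deriveMr (circle r x * resolvent r w x)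
    (path_derive_comp (p := s^~ x) (fd (sr _ _ tI)) sl).
  move=> /path_derive_eq; apply.
  have rE : (circle r x - w) * resolvent r w x = 1.
    by rewrite /resolvent mulfV// circle_sub_neq0.
  rewrite /dF; have -> : f' (s t x) * (circle r x - w) * (circle r x * resolvent r w x)
    = f' (s t x) * circle r x * ((circle r x - w) * resolvent r w x) by ring.
  by rewrite rE mulr1.
have dFM t x : t \in `](-(1/4)), (5/4)[ -> normc (dF t x) <= M * r.
  move=> tI; rewrite normcM (circle_norm _ (ltW r0))//.
  by rewrite ler_wpM2r ?f'M ?sr// ltW.
have dF0 t : t \in `](-(1/4)), (5/4)[ -> circ_int (dF t) = 0.
  (* The primitive used for the other values of [t] has [t] in its denominator; at 0, [dF] is just
     [f' w] times the circle and has a primitive of its own. *)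
  move=> tI; have [t0|t0] := eqVneq t 0.
    apply: (circ_int_derive (p := fun x => - 'i * f' w * circle r x)) => //.
    - exact: dFc.
    - move=> x; apply: path_derive_eq (path_deriveMl _ (circle_derive r x)) _.
      rewrite /dF /s t0 mul0r addr0.
      have -> : - 'i * f' w * ('i * circle r x) = - 'i ^+ 2 * (f' w * circle r x) by ring.
      by rewrite sqr_i opprK mul1r.
    - by rewrite circle_period.
  have t0' : (t%:C : C) != 0 by rewrite eq_complex /= (negbTE t0).
  apply: (circ_int_derive (p := fun x => (- 'i / t%:C) * f (s t x))) => //.
  - exact: dFc.
  - move=> x; apply: path_derive_eq (path_deriveMl _
      (path_derive_comp (fd (sr _ _ tI)) (sd t x))) _.
    have -> : - 'i / t%:C * (f' (s t x) * (t%:C * ('i * circle r x)))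
      = - 'i ^+ 2 * (f' (s t x) * circle r x) by field.
    by rewrite sqr_i opprK mul1r.
  - by rewrite /s circle_period.
have F01 : circ_int (F 1) = circ_int (F 0).
  apply/eqP; rewrite -subr_eq0; apply/eqP/eq0_normc/eqP.
  rewrite eq_le normc_ge0 andbT.
  have := @path_derive_mvt _ (fun t => circ_int (F t)) (fun=> 0) 0 1 0.
  rewrite mulr0 mul0r; apply=> t; rewrite min_l ?max_r// => t01.
  have tI : t \in `](-(1/4)), (5/4)[ by rewrite in_itv /=; have := r0; lra.
  split; last by rewrite normc0.
  by rewrite -(dF0 t tI); apply: (circ_int_under Fc Fd dFM tI).
have -> : kernel (fun t => f (circle r t) * circle r t) r 1 w = circ_int (F 1).
  congr circ_int; apply/funext => x.
  by rewrite /F /s mul1r [w + _]addrC subrK expr1 mulrA.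
rewrite F01 -(kernel_circle r0 wr2) mulrC -circ_intZ; last first.
  exact (kernel_continuous (circle_continuous r) r0 1 wr2).
congr circ_int; apply/funext => x.
by rewrite /F /s mul0r addr0 expr1.
Qed.

(** Differentiating Cauchy's formula makes [f'] a multiple of [kernel 2], hence its derivative [g] a
    multiple of [kernel 3]. Continuity of [g] is asked at the centre only, since the disc will be
    moved to every point of the domain. *)
Lemma derivative_cderive_ball : exists2 g : C -> C,
  (forall w, normc w < r / 4 -> is_derive w 1 f' (g w)) &
  {for (0 : C), continuous g}.
Proof.
pose a t := f (circle r t) * circle r t.
have ca : path_continuous a.
  apply: path_derive_continuous => t; apply: path_deriveM (circle_derive r t).
  apply: path_derive_comp (circle_derive r t); apply: fd.
  by rewrite (circle_norm _ (ltW r0))// mulr_natl mulr2n ltrDl.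
have aM t : normc (a t) <= M * r.
  rewrite normcM (circle_norm _ (ltW r0)) (ler_wpM2r (ltW r0))// fM//.
  by rewrite (circle_norm _ (ltW r0))//; have := r0; lra.
have r4 : 0 < r / 4 by rewrite divr_gt0.
have f'E z : normc z < r / 4 -> f' z = (T%:C)^-1 * kernel a r 2 z.
  move=> zr; have zr2 : normc z < r / 2 by have := r0; lra.
  apply: (@cderive_unique _ f z); first by apply: fd; have := r0; lra.
  have k0 : 0 < r / 4 - normc z by rewrite subr_gt0.
  apply: (cderive_near (f := fun w => (T%:C)^-1 * kernel a r 1 w) k0).
    move=> h hk; rewrite -cauchy_formula//.
    by rewrite (le_lt_trans (ler_normcD _ _))// addrC -ltrBrDr.
  have := cderiveM (is_derive_cst (T%:C^-1 : C) z 1) (kernel1_derive ca aM r0 zr2).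
  by rewrite mul0r add0r.
exists (fun w => (T%:C)^-1 * (2 * kernel a r 3 w)).
  move=> w wr; have k0 : 0 < r / 4 - normc w by rewrite subr_gt0.
  apply: (cderive_near (f := fun w => (T%:C)^-1 * kernel a r 2 w) k0).
    move=> h hk; rewrite f'E//.
    by rewrite (le_lt_trans (ler_normcD _ _))// addrC -ltrBrDr.
  have wr2 : normc w < r / 2 by have := r0; lra.
  have := cderiveM (is_derive_cst (T%:C^-1 : C) w 1) (kernel2_derive ca aM r0 wr2).
  by rewrite mul0r add0r.
have z2 : normc (0 : C) < r / 2 by rewrite normc0 divr_gt0.
have := cderiveM (is_derive_cst (2 : C) (0 : C) 1) (kernel3_derive ca aM r0 z2).
by move/(cderiveM (is_derive_cst (T%:C^-1 : C) (0 : C) 1))/cderive_continuous.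
Qed.

End ball.

Theorem derivative_cderive (D : set C) f f' z : open D -> D z ->
  (forall w, D w -> is_derive w 1 f (f' w)) ->
  (forall w, D w -> {for w, continuous f'}) ->
  is_derive z 1 f' ('D_1 f' z) /\ {for z, continuous ('D_1 f')}.
Proof.
move=> oD Dz fd f'c.
have [k k0 kP] := open_normcP oD Dz.
have /ccontinuousP/(_ 1 ltr01)[l l0 lP] := f'c z Dz.
have /ccontinuousP/(_ 1 ltr01)[m m0 mP] := cderive_continuous (fd z Dz).
(* Within [2 * r] of [z] the values of [f] and [f'] differ by less than 1 from those at [z], which
   gives the common bound [M]. *)
pose r := Num.min k (Num.min l m) / 2.
have r0 : 0 < r by rewrite divr_gt0// !lt_min k0 l0.
have rP h : normc h < 2 * r ->
    [/\ D (z + h), normc (f' (z + h) - f' z) < 1 & normc (f (z + h) - f z) < 1].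
  have -> : 2 * r = Num.min k (Num.min l m) by rewrite /r mulrC divfK.
  by rewrite !lt_min => /and3P[/kP ? /lP ? /mP ?].
pose M := normc (f z) + normc (f' z) + 1.
have [||||g gd gc] := @derivative_cderive_ball (fun w => f (z + w)) (fun w => f' (z + w)) r M r0.
- by move=> w /rP[Dw _ _]; apply/cderive_shift; exact: fd.
- move=> w /rP[Dw _ _]; have /ccontinuousP H := f'c _ Dw.
  by apply/ccontinuousP => e /H[j j0 jP]; exists j => // h /jP; rewrite addrA.
- move=> w /rP[_ _ H]; have := ler_normcD (f (z + w) - f z) (f z).
  by rewrite subrK /M; have := normc_ge0 (f' z); lra.
- move=> w /rP[_ H _]; have := ler_normcD (f' (z + w) - f' z) (f' z).
  by rewrite subrK /M; have := normc_ge0 (f z); lra.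
have r4 : 0 < r / 4 by rewrite divr_gt0.
have gE w : normc w < r / 4 -> is_derive (z + w) 1 f' (g w).
  by move=> /gd; move/cderive_shift.
split.
  have := gE 0; rewrite addr0 normc0 => /(_ r4) gz.
  by split; [have [] := gz|].
apply/ccontinuousP => e e0.
have /ccontinuousP/(_ _ e0)[j j0 jP] := gc.
exists (Num.min j (r / 4)); first by rewrite lt_min j0.
move=> h; rewrite lt_min => /andP[/jP + hr]; rewrite add0r.
have [_ ->] := gE h hr.
have [|_] := gE 0; first by rewrite normc0.
by rewrite addr0 => ->.
Qed.

End cauchy_formula.

(** * Stem functions in complex coordinates *)

Section coordinates.
Variable R : realType.
Local Notation C := R[i].
Implicit Types (q : quat R) (u v : quatC R) (F G : C -> quatC R) (D : set C) (z w : C) (k : nat).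

(* All indices k >= 3 stand for the last coordinate. *)
Definition qcoord k q : R :=
  match k with 0 => qre q | 1 => qi q | 2 => qj q | _ => qk q end.

Definition ccoord k u : C := qcoord k u.1 +i* qcoord k u.2.

Lemma qcoord_ext q q' : (forall k, qcoord k q = qcoord k q') -> q = q'.
Proof.
by move=> H; apply: quat_eqP; [exact: (H 0)|exact: (H 1)|exact: (H 2)|exact: (H 3)].
Qed.

Lemma ccoord_ext u v : (forall k, ccoord k u = ccoord k v) -> u = v.
Proof.
move=> H; rewrite [u]surjective_pairing [v]surjective_pairing.
by congr pair; apply: qcoord_ext => k; have [] := H k.
Qed.

Lemma qcoordD k q q' : qcoord k (q + q') = qcoord k q + qcoord k q'.
Proof. by case: k => [|[|[|k]]]. Qed.

Lemma qcoordN k q : qcoord k (- q) = - qcoord k q.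
Proof. by case: k => [|[|[|k]]]. Qed.

Lemma qcoordZ k (a : R) q : qcoord k (a *: q) = a * qcoord k q.
Proof. by case: k => [|[|[|k]]]. Qed.

Lemma qcoord0 k : qcoord k 0 = 0.
Proof. by case: k => [|[|[|k]]]. Qed.

Lemma ccoordD k u v : ccoord k (u + v) = ccoord k u + ccoord k v.
Proof. by apply: complex_ext; rewrite /= qcoordD. Qed.

Lemma ccoordN k u : ccoord k (- u) = - ccoord k u.
Proof. by apply: complex_ext; rewrite /= qcoordN. Qed.

Lemma ccoord0 k : ccoord k 0 = 0.
Proof. by apply: complex_ext; rewrite /= qcoord0. Qed.

Lemma ccoordZ k (a : R) u : ccoord k (a *: u) = a%:C * ccoord k u.
Proof. by apply: complex_ext; rewrite !ReImE /= qcoordZ; ring. Qed.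

Lemma ccoord_conj k u : ccoord k (quatC_conj u) = conjc (ccoord k u).
Proof. by apply: complex_ext; rewrite /= ?qcoordN. Qed.

Lemma ccoord_iota k u : ccoord k (iotaC R * u) = 'i * ccoord k u.
Proof.
rewrite quatC_mulE /quatC_mul /= !mul0r !mul1r add0r.
by apply: complex_ext; rewrite !ReImE /= ?qcoordD ?qcoordN ?qcoord0; ring.
Qed.

Lemma ccoordM k u v : ccoord k (u * v) =
  match k with
  | 0 => ccoord 0 u * ccoord 0 v - ccoord 1 u * ccoord 1 v
         - ccoord 2 u * ccoord 2 v - ccoord 3 u * ccoord 3 v
  | 1 => ccoord 0 u * ccoord 1 v + ccoord 1 u * ccoord 0 v
         + ccoord 2 u * ccoord 3 v - ccoord 3 u * ccoord 2 v
  | 2 => ccoord 0 u * ccoord 2 v - ccoord 1 u * ccoord 3 v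
         + ccoord 2 u * ccoord 0 v + ccoord 3 u * ccoord 1 v
  | _ => ccoord 0 u * ccoord 3 v + ccoord 1 u * ccoord 2 v
         - ccoord 2 u * ccoord 1 v + ccoord 3 u * ccoord 0 v
  end.
Proof.
case: u v => [[[[? ?] ?] ?] [[[? ?] ?] ?]] [[[[? ?] ?] ?] [[[? ?] ?] ?]].
by case: k => [|[|[|k]]]; apply: complex_ext; rewrite !ReImE /=
  /qre /qi /qj /qk /= /qre /qi /qj /qk /=; ring.
Qed.

Lemma qcoord_norm k q : `|qcoord k q| <= `|q|.
Proof.
case: q => [[[a b] c] d].
rewrite /Num.norm /= !le_max.
by case: k => [|[|[|k]]]; rewrite /= ?lexx ?orbT.
Qed.

Lemma qnorm_lt q (e : R) : (forall k, `|qcoord k q| < e) -> `|q| < e.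
Proof.
case: q => [[[a b] c] d] H; rewrite /Num.norm /= !gt_max.
by have := H 0; have := H 1; have := H 2; have := H 3; rewrite /= => -> -> -> ->.
Qed.

Lemma quatC_normE u : `|u| = Num.max `|u.1| `|u.2|.
Proof. by []. Qed.

Lemma fst_norm u : `|u.1| <= `|u|.
Proof. by rewrite [leRHS]quatC_normE le_max; apply/orP; left. Qed.

Lemma snd_norm u : `|u.2| <= `|u|.
Proof. by rewrite [leRHS]quatC_normE le_max; apply/orP; right. Qed.

Lemma ccoord_norm k u : normc (ccoord k u) <= 2 * `|u|.
Proof.
have h1 : `|Re (ccoord k u)| <= `|u| := le_trans (qcoord_norm k u.1) (fst_norm u).
have h2 : `|Im (ccoord k u)| <= `|u| := le_trans (qcoord_norm k u.2) (snd_norm u).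
have := le_trans (normc_le _) (lerD h1 h2).
by move=> ?; rewrite [leRHS]mulr_natl mulr2n.
Qed.

Lemma quatC_norm_lt u (e : R) : (forall k, normc (ccoord k u) < e) -> `|u| < e.
Proof.
move=> H; rewrite [ltLHS]quatC_normE gt_max.
apply/andP; split; apply: qnorm_lt => k.
  exact: le_lt_trans (normc_Re (ccoord k u)) (H k).
exact: le_lt_trans (normc_Im (ccoord k u)) (H k).
Qed.

Lemma continuous_quatCP F z : {for z, continuous F} <->
  forall k, {for z, continuous (fun w => ccoord k (F w))}.
Proof.
split=> [/cvgrPdistC_lt H k|H].
  apply/ccontinuousP => e e0.
  have /H/nbhs_ballP[j /= j0 jP] : 0 < e / 2 by rewrite divr_gt0.
  have [j0' jE] := complex_gt0P j0.
  exists (Re j) => // h hj.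
  have H' : `|F (z + h) - F z| < e / 2.
    by apply: jP; rewrite /ball /= opprD addNKr normrN normrcE jE ltcR.
  change (normc (ccoord k (F (z + h)) - ccoord k (F z)) < e).
  rewrite -ccoordN -ccoordD (le_lt_trans (ccoord_norm _ _))//.
  lra.
apply/(cvgrPdist_lt (FF := nbhs_filter z)) => e e0.
have C4 : exists2 j : R, 0 < j &
    forall h k, normc h < j -> normc (ccoord k (F (z + h)) - ccoord k (F z)) < e.
  have /ccontinuousP/(_ _ e0)[j0 p0 P0] := H 0.
  have /ccontinuousP/(_ _ e0)[j1 p1 P1] := H 1.
  have /ccontinuousP/(_ _ e0)[j2 p2 P2] := H 2.
  have /ccontinuousP/(_ _ e0)[j3 p3 P3] := H 3.
  exists (Num.min (Num.min j0 j1) (Num.min j2 j3)); first by rewrite !lt_min p0 p1 p2.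
  move=> h k; rewrite !lt_min => /andP[/andP[/P0 h0 /P1 h1] /andP[/P2 h2 /P3 h3]].
  by case: k => [|[|[|k]]].
have [j j0 jP] := C4.
apply/nbhs_ballP; exists j%:C; first by rewrite /= ltcR.
move=> w; rewrite /ball /= !normrcE !ltcR => wj.
rewrite distrC; apply: quatC_norm_lt => k; rewrite ccoordD ccoordN.
have := jP (w - z) k; rewrite [z + _]addrC subrK; apply.
by rewrite normc_distC.
Qed.

Lemma is_derive_quatCP (p : R -> quatC R) (t : R) (d : quatC R) :
  is_derive t 1 p d <->
  forall k, path_derive (fun s => ccoord k (p s)) t (ccoord k d).
Proof.
split=> [/is_derive_epsP H k|H].
  apply/path_deriveP => e e0.
  have [|j j0 jP] := H (e / 2); first by rewrite divr_gt0.
  exists j => // h /jP {}jP.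
  have -> : ccoord k (p (t + h)) - ccoord k (p t) - ccoord k d * h%:C =
      ccoord k (p (t + h) - p t - h *: d).
    by rewrite !(ccoordD, ccoordN) ccoordZ [h%:C * _]mulrC.
  rewrite (le_trans (ccoord_norm _ _))// mulrC -ler_pdivlMr//.
  by rewrite (le_trans jP)// mulrAC.
apply/is_derive_epsP => e e0.
have H' k : exists2 j : R, 0 < j & forall h, `|h| < j ->
    normc (ccoord k (p (t + h) - p t - h *: d)) <= e / 2 * `|h|.
  have /path_deriveP/(_ (e / 2))[|j j0 jP] := H k; first by rewrite divr_gt0.
  exists j => // h /jP; congr (_ <= _); congr normc.
  by rewrite !(ccoordD, ccoordN) ccoordZ [h%:C * _]mulrC.
have [[j0 p0 P0] [j1 p1 P1]] := (H' 0, H' 1).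
have [[j2 p2 P2] [j3 p3 P3]] := (H' 2, H' 3).
exists (Num.min (Num.min j0 j1) (Num.min j2 j3)); first by rewrite !lt_min p0 p1 p2.
move=> h; rewrite !lt_min => /andP[/andP[/P0 h0 /P1 h1] /andP[/P2 h2 /P3 h3]].
(* [quatC_norm_lt] is strict; the strictness comes from replacing [e] by [e / 2], which helps only
   when [h] is nonzero. *)
have [->|hn0] := eqVneq h 0.
  by rewrite addr0 subrr scale0r subr0 !normr0 mulr0.
apply/ltW/quatC_norm_lt => k.
apply: (@le_lt_trans _ _ (e / 2 * `|h|)); first by case: k => [|[|[|k]]].
by rewrite ltr_pM2r ?normr_gt0// ltr_pdivrMr// mulr_natr mulr2n ltrDl.
Qed.

End coordinates.

(** * Derivatives of stem functions in the complex variable *)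

Section stem_derivatives.
Variable R : realType.
Local Notation C := R[i].
Implicit Types (q : quat R) (u v : quatC R) (F G : C -> quatC R) (D : set C) (z w : C) (k : nat).

(** H (x) C is normed over the reals, so a derivative in the complex variable is expressed through
    the complex coordinates. *)
Definition stem_derive F z (d : quatC R) :=
  forall k, is_derive z 1 (fun w => ccoord k (F w)) (ccoord k d).

Lemma cderive_ext (f g : C -> C) z (d : C) : f =1 g ->
  is_derive z 1 f d -> is_derive z 1 g d.
Proof. by move=> /funext ->. Qed.

Lemma stem_derive_eq F z u v : stem_derive F z u -> u = v -> stem_derive F z v.
Proof. by move=> + <-. Qed.

Lemma stem_derive_unique F z u v : stem_derive F z u -> stem_derive F z v -> u = v.
Proof. by move=> Fu Fv; apply: ccoord_ext => k; exact: cderive_unique (Fu k) (Fv k). Qed.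

Lemma stem_derive_cst u z : stem_derive (fun=> u) z 0.
Proof. by move=> k; rewrite ccoord0; exact: is_derive_cst. Qed.

Lemma stem_deriveD F G z u v : stem_derive F z u -> stem_derive G z v ->
  stem_derive (fun w => F w + G w) z (u + v).
Proof.
move=> Fu Gv k; rewrite ccoordD.
apply: (cderive_ext (fun w => esym (ccoordD k (F w) (G w)))).
exact: is_deriveD (Fu k) (Gv k).
Qed.

Lemma stem_deriveB F G z u v : stem_derive F z u -> stem_derive G z v ->
  stem_derive (fun w => F w - G w) z (u - v).
Proof.
move=> Fu Gv k; rewrite ccoordD ccoordN.
apply: (cderive_ext (f := fun w => ccoord k (F w) - ccoord k (G w))).
  by move=> w; rewrite ccoordD ccoordN.
exact: is_deriveB (Fu k) (Gv k).
Qed.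

Lemma stem_deriveM F G z u v : stem_derive F z u -> stem_derive G z v ->
  stem_derive (fun w => F w * G w) z (u * G z + F z * v).
Proof.
move=> Fu Gv k; apply: (cderive_ext (fun w => esym (ccoordM k (F w) (G w)))).
have m i j := cderiveM (Fu i) (Gv j).
rewrite ccoordD (ccoordM k u (G z)) (ccoordM k (F z) v).
case: k => [|[|[|k]]].
- apply: is_derive_eq (is_deriveB (is_deriveB (is_deriveB
    (m 0 0) (m 1 1)) (m 2 2)) (m 3 3)) _; ring.
- apply: is_derive_eq (is_deriveB (is_deriveD (is_deriveD
    (m 0 1) (m 1 0)) (m 2 3)) (m 3 2)) _; ring.
- apply: is_derive_eq (is_deriveD (is_deriveD (is_deriveB
    (m 0 2) (m 1 3)) (m 2 0)) (m 3 1)) _; ring.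
- apply: is_derive_eq (is_deriveD (is_deriveB (is_deriveD
    (m 0 3) (m 1 2)) (m 2 1)) (m 3 0)) _; ring.
Qed.

Lemma stem_deriveMr F z u v : stem_derive F z u ->
  stem_derive (fun w => F w * v) z (u * v).
Proof.
move=> Fu; apply: stem_derive_eq (stem_deriveM Fu (stem_derive_cst v z)) _.
by rewrite mulr0 addr0.
Qed.

Lemma stem_derive_near D F G z u : open D -> D z -> (forall w, D w -> F w = G w) ->
  stem_derive F z u -> stem_derive G z u.
Proof.
move=> oD Dz FG Fu k; have [r r0 rP] := open_normcP oD Dz.
by apply: (cderive_near r0 _ (Fu k)) => h /rP/FG ->.
Qed.

Lemma stem_derive0_cst F : (forall z, stem_derive F z 0) -> forall z, F z = F 0.
Proof.
move=> F0 z; apply: ccoord_ext => k.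
have n : normc z < normc z + 1 by rewrite ltrDl.
apply: (cderive0_ball (f := fun w => ccoord k (F w)) _ n) => w _.
by have := F0 w k; rewrite ccoord0.
Qed.

Lemma path_derive_re (t y : R) : path_derive (fun s => s +i* y) t 1.
Proof. by split => /=; [exact: is_derive_id|exact: is_derive_cst]. Qed.

Lemma path_derive_im (t x : R) : path_derive (fun s => x +i* s) t 'i.
Proof. by split => /=; [exact: is_derive_cst|exact: is_derive_id]. Qed.

Lemma stem_derive_partial F z u : stem_derive F z u ->
  is_derive (Re z) 1 (fun t : R => F (t +i* Im z)) u /\
  is_derive (Im z) 1 (fun t : R => F (Re z +i* t)) (iotaC R * u).
Proof.
case: z => x y Fu; split; apply/is_derive_quatCP => k.
  by have := path_derive_comp (Fu k) (path_derive_re x y); rewrite mulr1.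
by have := path_derive_comp (Fu k) (path_derive_im y x); rewrite mulrC -ccoord_iota.
Qed.

Lemma iotaC_sqr u : iotaC R * (iotaC R * u) = - u.
Proof.
by apply: ccoord_ext => k; rewrite !ccoord_iota ccoordN mulrA -expr2 sqr_i mulN1r.
Qed.

Lemma half_double u : (2%:R^-1 : R) *: (u + u) = u.
Proof.
have -> : u + u = (2%:R : R) *: u by rewrite scaler_nat mulr2n.
by rewrite scalerA mulVf ?scale1r.
Qed.

Lemma stem_derive_d F z u : stem_derive F z u ->
  [/\ dalpha F z = u, dbeta F z = iotaC R * u, dz F z = u & dzbar F z = 0].
Proof.
move=> /stem_derive_partial[[_ da] [_ db]].
have dau : dalpha F z = u by rewrite /dalpha derive1E.
have dbu : dbeta F z = iotaC R * u by rewrite /dbeta derive1E.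
split=> //; first by rewrite /dz dau dbu iotaC_sqr opprK half_double.
by rewrite /dzbar dau dbu iotaC_sqr subrr scaler0.
Qed.

Lemma normc_conjc z : normc (conjc z) = normc z.
Proof. by case: z => a b /=; rewrite sqrrN. Qed.

(** Conjugation is an isometry, so the increment estimate at [z] becomes the one at [conjc z]. This
    makes the derivative of a stem function a stem function again. *)
Lemma stem_derive_conj D F z u : open D -> (forall w, D w -> D (conjc w)) ->
  stem_function D F -> D z -> stem_derive F z u ->
  stem_derive F (conjc z) (quatC_conj u).
Proof.
move=> oD Dc sF Dz Fu k; have [r r0 rP] := open_normcP oD Dz.
have /cderiveP H := Fu k; apply/cderiveP => e /H[j j0 jP].
exists (Num.min j r); first by rewrite lt_min j0.
move=> h; rewrite lt_min => /andP[hj hr].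
have {}hj : normc (conjc h) < j by rewrite normc_conjc.
have {}hr : normc (conjc h) < r by rewrite normc_conjc.
have -> : conjc z + h = conjc (z + conjc h) by rewrite rmorphD /= conjcK.
rewrite !sF//; last exact: rP.
rewrite !ccoord_conj -{2}(conjcK h) -rmorphM -!rmorphB normc_conjc.
by rewrite -(normc_conjc h); exact: jP.
Qed.

Lemma holomorphic_stemI D F (F' : C -> quatC R) : open D -> stem_function D F ->
  (forall z, D z -> stem_derive F z (F' z)) ->
  (forall z, D z -> {for z, continuous F'}) -> holomorphic_stem D F.
Proof.
move=> oD sF FF' cF'; split=> // [z Dz|z /FF'/stem_derive_d[]//].
have [[da _] [db _]] := stem_derive_partial (FF' z Dz).
(* The partial derivatives are known to be [F'] and iota times [F'] on [D] only, so continuity has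
   to be carried across an equality that holds near [z]. *)
have cont (H : C -> quatC R) (g : C -> quatC R) : (forall w, D w -> H w = g w) ->
    {for z, continuous g} -> {for z, continuous H}.
  move=> Hg /continuous_quatCP cg; apply/continuous_quatCP => k.
  apply/ccontinuousP => e e0; have [r r0 rP] := open_normcP oD Dz.
  have /ccontinuousP/(_ _ e0)[j j0 jP] := cg k.
  exists (Num.min j r); first by rewrite lt_min j0.
  move=> h; rewrite lt_min => /andP[hj /rP Dh].
  by rewrite (Hg _ Dh) (Hg _ Dz); exact: jP.
split; [exact: da|exact: db| |].
  by apply: (cont _ F') (cF' z Dz) => w /FF'/stem_derive_d[].
apply: (cont _ (fun w => iotaC R * F' w)) => [w /FF'/stem_derive_d[]//|].
apply/continuous_quatCP => k; have /continuous_quatCP/(_ k) := cF' z Dz.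
move=> /ccontinuousP c; apply/ccontinuousP => e /c[j j0 jP].
exists j => // h /jP; rewrite !ccoord_iota -mulrBr normcM.
by rewrite {2}/normc /= expr0n /= add0r expr1n sqrtr1 mul1r.
Qed.

(** The Cauchy-Riemann equation makes the beta-derivative iota times the alpha-derivative. Hence
    [dz F] is [dalpha F] on [D], and since iota acts as the complex unit on every coordinate,
    [cauchy_riemann_cderive] applies. *)
Lemma holomorphic_stem_cderive D F z : open D -> holomorphic_stem D F -> D z ->
  stem_derive F z (dz F z).
Proof.
move=> oD [sF c1 cr] Dz.
have cr' w : D w -> dbeta F w = iotaC R * dalpha F w.
  move=> /cr/eqP; rewrite scaler_eq0 invr_eq0 pnatr_eq0 /=.
  rewrite addr_eq0 => /eqP ->.
  by rewrite mulrN iotaC_sqr opprK.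
have dzE w : D w -> dz F w = dalpha F w.
  by move=> Dw; rewrite /dz cr'// iotaC_sqr opprK half_double.
rewrite dzE// => k.
apply: (@cauchy_riemann_cderive _ D _ (fun w => ccoord k (dalpha F w))) => //.
- move=> w /c1[d1 _ _ _].
  apply: (is_derive_quatCP (fun t => F (t +i* Im w)) (Re w) (dalpha F w)).1.
  by rewrite /dalpha derive1E; exact: derivableP.
- move=> w Dw; have [_ d1 _ _] := c1 w Dw; rewrite -ccoord_iota -cr'//.
  apply: (is_derive_quatCP (fun t => F (Re w +i* t)) (Im w) (dbeta F w)).1.
  by rewrite /dbeta derive1E; exact: derivableP.
- by have [_ _ + _] := c1 z Dz; move/continuous_quatCP; apply.
Qed.

Lemma stem_derive_continuous F z u : stem_derive F z u -> {for z, continuous F}.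
Proof.
by move=> Fu; apply/continuous_quatCP => k; exact: cderive_continuous (Fu k).
Qed.

Lemma holomorphic_stem_dz D F : open D -> (forall w, D w -> D (conjc w)) ->
  holomorphic_stem D F -> holomorphic_stem D (dz F).
Proof.
move=> oD Dc hF; have [sF c1 cr] := hF.
have FF' z Dz := holomorphic_stem_cderive oD hF (z := z) Dz.
have cdz z : D z -> {for z, continuous (dz F)}.
  move=> Dz; apply/continuous_quatCP => k.
  have [_ _ ca _] := c1 z Dz; have /continuous_quatCP/(_ k) := ca.
  move=> /ccontinuousP c; apply/ccontinuousP => e e0.
  have [r r0 rP] := open_normcP oD Dz; have [j j0 jP] := c e e0.
  exists (Num.min j r); first by rewrite lt_min j0.
  move=> h; rewrite lt_min => /andP[/jP + /rP/FF'/stem_derive_d[<- _ _ _]].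
  by have /stem_derive_d[<- _ _ _] := FF' z Dz.
have H z (Dz : D z) k : is_derive z 1 (fun w => ccoord k (dz F w))
      ('D_1 (fun w => ccoord k (dz F w)) z) /\
    {for z, continuous ('D_1 (fun w => ccoord k (dz F w)))}.
  apply: (@derivative_cderive _ D (fun w => ccoord k (F w))) => //.
    by move=> w Dw; exact: FF'.
  by move=> w /cdz/continuous_quatCP.
pose d k w := 'D_1 (fun w' => ccoord k (dz F w')) w.
(* Cauchy's formula yields the second derivative of each coordinate; the value in H (x) C is
   reassembled from the four. *)
pose F'' w : quatC R :=
  ((Re (d 0 w), Re (d 1 w), Re (d 2 w), Re (d 3 w)),
   (Im (d 0 w), Im (d 1 w), Im (d 2 w), Im (d 3 w))).
have F''E k w : ccoord k (F'' w) = d k w.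
  by case: k => [|[|[|k]]]; apply: complex_ext.
apply: (holomorphic_stemI (F' := F'') oD) => [z Dz|z Dz k|z Dz].
- have conjD := stem_derive_conj oD Dc sF Dz (FF' z Dz).
  exact: stem_derive_unique (FF' _ (Dc z Dz)) conjD.
- by rewrite F''E; exact: (H z Dz k).1.
- apply/continuous_quatCP => k.
  by rewrite (_ : (fun w => _) = d k); [exact: (H z Dz k).2|apply/funext].
Qed.

End stem_derivatives.

(** * Exponential series *)

Section exponential_series.
Variable R : realType.
Local Notation C := R[i].
Implicit Types (a b : nat -> R) (z w h l : C) (U V : nat -> C) (k n N : nat).

Definition ccvg U l :=
  (fun n => Re (U n)) @ \oo --> Re l /\ (fun n => Im (U n)) @ \oo --> Im l.

Lemma ccvg_unique U l l' : ccvg U l -> ccvg U l' -> l = l'.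
Proof.
move=> [r i] [r' i']; apply: complex_ext.
  exact: cvg_unique r r'.
exact: cvg_unique i i'.
Qed.

Lemma ccvg_ext U V l : U =1 V -> ccvg U l -> ccvg V l.
Proof. by move=> /funext ->. Qed.

Lemma ccvgD U V l m : ccvg U l -> ccvg V m -> ccvg (fun n => U n + V n) (l + m).
Proof.
move=> [? ?] [? ?]; split; rewrite ReImE; under eq_fun do rewrite ReImE;
  exact: cvgD.
Qed.

Lemma ccvgB U V l m : ccvg U l -> ccvg V m -> ccvg (fun n => U n - V n) (l - m).
Proof.
move=> [? ?] [? ?]; split; rewrite !ReImE; under eq_fun do rewrite !ReImE;
  exact: cvgB.
Qed.

Lemma ccvgMl U l c : ccvg U l -> ccvg (fun n => c * U n) (c * l).
Proof.
move=> [? ?]; split; rewrite ReImE; under eq_fun do rewrite ReImE.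
  by apply: cvgB; apply: cvgM => //; exact: cvg_cst.
by apply: cvgD; apply: cvgM => //; exact: cvg_cst.
Qed.

Lemma ccvg_shift U l : ccvg U l -> ccvg (fun n => U n.+1) l.
Proof.
by move=> [r i]; split; [move: r|move: i]; rewrite -cvg_shiftS.
Qed.

Lemma cvg_norm_le (u : nat -> R) (x B : R) : u @ \oo --> x ->
  (forall n, `|u n| <= B) -> `|x| <= B.
Proof.
move=> ux uB; have nux : (fun n => `|u n|) @ \oo --> `|x| by exact: cvg_norm.
rewrite -(cvg_lim (@Rhausdorff R) nux); apply: limr_le.
  by apply/cvg_ex; exists `|x|.
by apply: nearW => n; exact: uB.
Qed.

Lemma ccvg_norm_le U l (B : R) : ccvg U l -> (forall n, normc (U n) <= B) ->
  normc l <= 2 * B.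
Proof.
move=> [r i] UB; rewrite (le_trans (normc_le _))// [leRHS]mulr_natl mulr2n lerD//.
  by apply: (cvg_norm_le r) => n; rewrite (le_trans (normc_Re _)).
by apply: (cvg_norm_le i) => n; rewrite (le_trans (normc_Im _)).
Qed.

Lemma normcX z n : normc (z ^+ n) = normc z ^+ n.
Proof.
elim: n => [|n IH]; first by rewrite !expr0 normc1.
by rewrite !exprS normcM IH.
Qed.

Lemma normc_sum (F : nat -> C) (r : seq nat) :
  normc (\sum_(n <- r) F n) <= \sum_(n <- r) normc (F n).
Proof.
elim: r => [|n r IH]; first by rewrite !big_nil normc0.
by rewrite !big_cons (le_trans (ler_normcD _ _))// lerD2l.
Qed.

(** Partial sum of an exponential generating function, for which differentiation is a shift of the
    sequence. Real sequences suffice, because the coordinates of a quaternionic coefficient are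
    real. *)
Definition expsum a z N : C := \sum_(0 <= n < N) (a n / n`!%:R)%:C * z ^+ n.

Definition expser a z : C :=
  limn (fun N => Re (expsum a z N)) +i* limn (fun N => Im (expsum a z N)).

Definition geometric_bound a (M K : R) := forall n, `|a n| <= M * K ^+ n.

Lemma ReSum (F : nat -> C) (r : seq nat) : Re (\sum_(n <- r) F n) = \sum_(n <- r) Re (F n).
Proof. exact: (big_morph _ (@ReD R) erefl). Qed.

Lemma ImSum (F : nat -> C) (r : seq nat) : Im (\sum_(n <- r) F n) = \sum_(n <- r) Im (F n).
Proof. exact: (big_morph _ (@ImD R) erefl). Qed.

Lemma normc_expterm a (M K : R) z n : geometric_bound a M K ->
  normc ((a n / n`!%:R)%:C * z ^+ n) <= M * exp_coeff (K * normc z) n.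
Proof.
move=> aMK; rewrite normcM normc_RC normcX normrM normfV normr_nat /exp_coeff /=.
rewrite exprMn !mulrA [leRHS]mulrAC ler_wpM2r ?exprn_ge0 ?normc_ge0//.
by rewrite ler_wpM2r ?invr_ge0.
Qed.

Lemma dominated_series_cvg (u : nat -> R) (M x : R) : 0 <= M -> 0 <= x ->
  (forall n, `|u n| <= M * exp_coeff x n) ->
  cvgn (fun N => \sum_(0 <= n < N) u n).
Proof.
move=> M0 x0 uM; apply: normed_cvg.
apply: (series_le_cvg (v_ := M *: exp_coeff x)); [| |exact: uM|].
- by move=> n; exact: normr_ge0.
- by move=> n; change (0 <= M * exp_coeff x n); rewrite mulr_ge0// exp_coeff_ge0.
- by apply: is_cvg_seriesZ; exact: is_cvg_series_exp_coeff.
Qed.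

Lemma expsum_cvg a (M K : R) z : 0 <= M -> 0 <= K -> geometric_bound a M K ->
  ccvg (expsum a z) (expser a z).
Proof.
move=> M0 K0 aMK; rewrite /ccvg /expser /=.
have x0 : 0 <= K * normc z by rewrite mulr_ge0 ?normc_ge0.
split.
  under eq_fun do rewrite /expsum ReSum.
  apply: (dominated_series_cvg M0 x0) => n.
  by rewrite (le_trans (normc_Re _))// normc_expterm.
under eq_fun do rewrite /expsum ImSum.
apply: (dominated_series_cvg M0 x0) => n.
by rewrite (le_trans (normc_Im _))// normc_expterm.
Qed.

(** Passing from n to n + 1 multiplies the remainder by [z + h] and adds [h ^+ 2] times the
    derivative of the n-th power. Both parts are at most half the new bound, the second because n is
    below the n-th power of 2 and [r] is at least 1. *)
Lemma taylor1_bound z h (r : R) n : 1 <= r -> normc z <= r -> normc (z + h) <= r ->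
  normc ((z + h) ^+ n - z ^+ n - n%:R * h * z ^+ n.-1) <= normc h ^+ 2 * (2 * r) ^+ n.
Proof.
move=> r1 zr zhr; have r0 : 0 <= r by rewrite (le_trans ler01).
elim: n => [|n IH].
  by rewrite !expr0 subrr mul0r mul0r subrr normc0 mulr1 sqr_ge0.
have -> : (z + h) ^+ n.+1 - z ^+ n.+1 - n.+1%:R * h * z ^+ n.+1.-1 =
    (z + h) * ((z + h) ^+ n - z ^+ n - n%:R * h * z ^+ n.-1) + h ^+ 2 * (n%:R * z ^+ n.-1).
  case: n {IH} => [|n] /=; first by rewrite !expr1 !expr0; ring.
  by rewrite !exprS -[n.+2%:R]natr1 -[n.+1%:R]natr1; ring.
rewrite (le_trans (ler_normcD _ _))// normcM [normc (h ^+ 2 * _)]normcM.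
rewrite [normc (h ^+ 2)]normcX [normc (n%:R * _)]normcM.
have h1 : normc (z + h) * normc ((z + h) ^+ n - z ^+ n - n%:R * h * z ^+ n.-1) <=
    normc h ^+ 2 * (r * (2 * r) ^+ n).
  by rewrite [leRHS]mulrCA ler_pM ?normc_ge0.
have h2 : normc h ^+ 2 * (normc (n%:R : C) * normc (z ^+ n.-1)) <=
    normc h ^+ 2 * (r * (2 * r) ^+ n).
  rewrite ler_wpM2l ?sqr_ge0// normcX exprMn mulrCA ler_pM ?normc_ge0 ?exprn_ge0 ?normc_ge0//.
    rewrite -(rmorph_nat (real_complex R)) normc_RC normr_nat -natrX ler_nat.
    by rewrite ltnW// ltn_expl.
  rewrite -exprS (le_trans (lerXn2r _ _ _ zr)) ?nnegrE ?normc_ge0//.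
  by rewrite ler_weXn2l// (leq_trans (leq_pred _)).
have -> : normc h ^+ 2 * (2 * r) ^+ n.+1 =
    normc h ^+ 2 * (r * (2 * r) ^+ n) + normc h ^+ 2 * (r * (2 * r) ^+ n).
  by rewrite [(2 * r) ^+ n.+1]exprS; ring.
exact: lerD h1 h2.
Qed.

Lemma series_exp_coeff_le (x : R) N : 0 <= x ->
  \sum_(0 <= n < N) exp_coeff x n <= expR x.
Proof.
move=> x0; apply: (@nondecreasing_cvgn_le _ (series (exp_coeff x))).
  by apply: nondecreasing_series => n _ _; exact: exp_coeff_ge0.
exact: is_cvg_series_exp_coeff.
Qed.

Lemma shift_geometric_bound a (M K : R) : geometric_bound a M K ->
  geometric_bound (fun n => a n.+1) (M * K) K.
Proof. by move=> aMK n; rewrite -mulrA -exprS. Qed.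

(** The Taylor remainders of the monomials add up to a multiple of [normc h ^+ 2], with a real
    exponential series as majorant. The radius [normc z + 1] covers [z + h] for [normc h < 1]. *)
Lemma expser_derive a (M K : R) z : 0 <= M -> 0 <= K -> geometric_bound a M K ->
  is_derive z 1 (expser a) (expser (fun n => a n.+1) z).
Proof.
move=> M0 K0 aMK; pose r := normc z + 1.
pose B := M * expR (K * (2 * r)).
have r0 : 0 <= r by rewrite addr_ge0 ?normc_ge0.
apply: (cderive_quadratic (r := 1) (M := 2 * B)) => // h h1.
rewrite -mulrA.
have cw w := expsum_cvg w M0 K0 aMK.
have c' := expsum_cvg z (mulr_ge0 M0 K0) K0 (shift_geometric_bound aMK).
(* The first two sequences are shifted so that [N.+1] terms of the series meet [N] terms of the
   derived one; the term n = 0 contributes nothing to the derivative. *)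
have := ccvgB (ccvgB (ccvg_shift (cw (z + h))) (ccvg_shift (cw z))) (ccvgMl h c').
rewrite [h * _]mulrC => /ccvg_norm_le; apply=> N.
have -> : expsum a (z + h) N.+1 - expsum a z N.+1 - h * expsum (fun n => a n.+1) z N =
    \sum_(0 <= n < N.+1) (a n / n`!%:R)%:C * ((z + h) ^+ n - z ^+ n - n%:R * h * z ^+ n.-1).
  have -> : h * expsum (fun n => a n.+1) z N =
      \sum_(0 <= n < N.+1) (a n / n`!%:R)%:C * (n%:R * h * z ^+ n.-1).
    rewrite big_nat_recl// !mul0r mulr0 add0r /expsum mulr_sumr.
    apply: eq_bigr => n _.
    have E : (a n.+1 / n`!%:R)%:C = (a n.+1 / n.+1`!%:R)%:C * n.+1%:R :> C.
      have -> : (n.+1%:R : C) = (n.+1%:R : R)%:C by rewrite rmorph_nat.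
      rewrite -rmorphM; congr (_ %:C).
      by rewrite factS natrM; field; rewrite nat1r !pnatr_eq0 -lt0n fact_gt0.
    by rewrite E /=; ring.
  rewrite /expsum -!sumrB; apply: eq_bigr => n _.
  by rewrite -!mulrBr.
rewrite (le_trans (normc_sum _ _))//.
apply: (@le_trans _ _ (\sum_(0 <= n < N.+1) M * normc h ^+ 2 * exp_coeff (K * (2 * r)) n)).
  apply: ler_sum => n _; rewrite normcM normc_RC normrM normfV normr_nat.
  have zr : normc z <= r by rewrite lerDl.
  have zhr : normc (z + h) <= r by rewrite (le_trans (ler_normcD _ _))// lerD2l ltW.
  have r1 : 1 <= r by rewrite lerDr normc_ge0.
  have T := taylor1_bound n r1 zr zhr.
  have -> : M * normc h ^+ 2 * exp_coeff (K * (2 * r)) n =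
      (M * K ^+ n) / n`!%:R * (normc h ^+ 2 * (2 * r) ^+ n).
    by rewrite /exp_coeff /= exprMn; ring.
  by rewrite ler_pM ?normc_ge0 ?mulr_ge0 ?invr_ge0// ler_wpM2r ?invr_ge0.
rewrite -mulr_sumr /B [leLHS]mulrAC ler_wpM2r ?sqr_ge0// ler_wpM2l//.
by apply: series_exp_coeff_le; rewrite mulr_ge0// mulr_ge0.
Qed.

End exponential_series.

(** The derivative of a product whose factors have derivatives [e * x] and [y * - x]; in the uses
    below [y] is E_{-x}. *)
Lemma mul_comm_cancel (A : pzRingType) (e x y : A) : x * y = y * x ->
  e * x * y + e * (y * - x) = 0.
Proof. by move=> xy; rewrite mulrN -xy mulrN mulrA subrr. Qed.

(** * Entire stem functions given by power series with quaternionic coefficients *)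

Section quaternionic_series.
Variable R : realType.
Local Notation C := R[i].
Implicit Types (q x : quat R) (u v : quatC R) (c d : nat -> quat R) (z w : C) (k n N : nat).

Definition qC q : quatC R := (q, 0).

Lemma qCM q q' : qC (q * q') = qC q * qC q'.
Proof. by rewrite quatC_mulE /quatC_mul /= !(mulr0, mul0r) subr0 addr0. Qed.

Lemma qCB q q' : qC (q - q') = qC q - qC q'.
Proof. by congr pair; rewrite /= subr0. Qed.

Lemma ccoord_qC k q : ccoord k (qC q) = (qcoord k q)%:C.
Proof. by apply: complex_ext; rewrite //= qcoord0. Qed.

(* The central embedding of C, i going to iota. *)
Definition zeta z : quatC R := ((Re z)%:A, (Im z)%:A).

Lemma zetaMl_fst z u : (zeta z * u).1 = Re z *: u.1 - Im z *: u.2.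
Proof. by rewrite quatC_mulE /quatC_mul /= -!scalerAl !mul1r. Qed.

Lemma zetaMl_snd z u : (zeta z * u).2 = Re z *: u.2 + Im z *: u.1.
Proof. by rewrite quatC_mulE /quatC_mul /= -!scalerAl !mul1r. Qed.

Lemma ccoord_zeta k z u : ccoord k (zeta z * u) = z * ccoord k u.
Proof.
apply: complex_ext; rewrite !ReImE.
  change (qcoord k (zeta z * u).1 = Re z * qcoord k u.1 - Im z * qcoord k u.2).
  by rewrite zetaMl_fst qcoordD qcoordN !qcoordZ.
change (qcoord k (zeta z * u).2 = Re z * qcoord k u.2 + Im z * qcoord k u.1).
by rewrite zetaMl_snd qcoordD !qcoordZ.
Qed.

Lemma zeta_central z u : zeta z * u = u * zeta z.
Proof.
rewrite !quatC_mulE; congr pair => /=.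
  by rewrite -!scalerAl -!scalerAr !mul1r !mulr1.
by rewrite -!scalerAl -!scalerAr !mul1r !mulr1 addrC.
Qed.

Lemma ccoord_zetaX k n z u : ccoord k (zeta z ^+ n * u) = z ^+ n * ccoord k u.
Proof.
elim: n => [|n IH]; first by rewrite !expr0 !mul1r.
by rewrite !exprS -!mulrA ccoord_zeta IH.
Qed.

Definition qcvg (U : nat -> quatC R) u := forall k, ccvg (fun n => ccoord k (U n)) (ccoord k u).

Lemma qcvg_unique U u v : qcvg U u -> qcvg U v -> u = v.
Proof. by move=> Uu Uv; apply: ccoord_ext => k; exact: ccvg_unique (Uu k) (Uv k). Qed.

Lemma qcvgMr U u v : qcvg U u -> qcvg (fun n => U n * v) (u * v).
Proof.
move=> Uu k; rewrite ccoordM.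
apply: (ccvg_ext (fun n => esym (ccoordM k (U n) v))).
have c j i : ccvg (fun n => ccoord j (U n) * ccoord i v) (ccoord j u * ccoord i v).
  apply: (ccvg_ext (fun n => mulrC _ _)); rewrite [_ * ccoord i v]mulrC.
  exact: ccvgMl.
case: k => [|[|[|k]]].
- exact: (ccvgB (ccvgB (ccvgB (c 0 0) (c 1 1)) (c 2 2)) (c 3 3)).
- exact: (ccvgB (ccvgD (ccvgD (c 0 1) (c 1 0)) (c 2 3)) (c 3 2)).
- exact: (ccvgD (ccvgD (ccvgB (c 0 2) (c 1 3)) (c 2 0)) (c 3 1)).
- exact: (ccvgD (ccvgB (ccvgD (c 0 3) (c 1 2)) (c 2 1)) (c 3 0)).
Qed.

Lemma qcvgMl U u v : qcvg U u -> qcvg (fun n => v * U n) (v * u).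
Proof.
move=> Uu k; rewrite ccoordM.
apply: (ccvg_ext (fun n => esym (ccoordM k v (U n)))).
have c j i : ccvg (fun n => ccoord j v * ccoord i (U n)) (ccoord j v * ccoord i u).
  exact: ccvgMl.
case: k => [|[|[|k]]].
- exact: (ccvgB (ccvgB (ccvgB (c 0 0) (c 1 1)) (c 2 2)) (c 3 3)).
- exact: (ccvgB (ccvgD (ccvgD (c 0 1) (c 1 0)) (c 2 3)) (c 3 2)).
- exact: (ccvgD (ccvgD (ccvgB (c 0 2) (c 1 3)) (c 2 0)) (c 3 1)).
- exact: (ccvgD (ccvgB (ccvgD (c 0 3) (c 1 2)) (c 2 1)) (c 3 0)).
Qed.

Lemma qcvgD U V u v : qcvg U u -> qcvg V v -> qcvg (fun n => U n + V n) (u + v).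
Proof.
move=> Uu Vv k; rewrite ccoordD.
apply: (ccvg_ext (fun n => esym (ccoordD k (U n) (V n)))).
exact: ccvgD (Uu k) (Vv k).
Qed.

(** Geometric growth of the coefficients gives convergence everywhere, and it passes to shifts and
    to products with a fixed quaternion. *)
Definition exp_bounded c := exists M K : R,
  [/\ 0 <= M, 0 <= K & forall k n, `|qcoord k (c n)| <= M * K ^+ n].

Definition stem_sum c z N : quatC R :=
  \sum_(0 <= n < N) (n`!%:R^-1 : R) *: (zeta z ^+ n * qC (c n)).

Definition stem_series c z : quatC R :=
  let s k := expser (fun n => qcoord k (c n)) z in
  ((Re (s 0), Re (s 1), Re (s 2), Re (s 3)),
   (Im (s 0), Im (s 1), Im (s 2), Im (s 3))).

Lemma ccoord_series c z k :
  ccoord k (stem_series c z) = expser (fun n => qcoord k (c n)) z.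
Proof. by case: k => [|[|[|k]]]; apply: complex_ext. Qed.

Lemma ccoord_sum c z k N :
  ccoord k (stem_sum c z N) = expsum (fun n => qcoord k (c n)) z N.
Proof.
rewrite /stem_sum (big_morph _ (ccoordD k) (ccoord0 R k)).
apply: eq_bigr => n _; rewrite ccoordZ ccoord_zetaX ccoord_qC.
by rewrite (rmorphM (real_complex R)); ring.
Qed.

Lemma stem_sum_cvg c z : exp_bounded c -> qcvg (stem_sum c z) (stem_series c z).
Proof.
move=> [M [K [M0 K0 cMK]]] k; rewrite ccoord_series.
apply: (ccvg_ext (fun N => esym (ccoord_sum c z k N))).
exact: (expsum_cvg z M0 K0 (cMK k)).
Qed.

Lemma stem_series_derive c z : exp_bounded c ->
  stem_derive (stem_series c) z (stem_series (fun n => c n.+1) z).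
Proof.
move=> [M [K [M0 K0 cMK]]] k.
apply: (is_derive_eq _ (esym (ccoord_series (fun n => c n.+1) z k))).
apply: (cderive_ext (fun w => esym (ccoord_series c w k))).
exact: (expser_derive z M0 K0 (cMK k)).
Qed.

Lemma exp_boundedS c : exp_bounded c -> exp_bounded (fun n => c n.+1).
Proof.
move=> [M [K [M0 K0 cMK]]]; exists (M * K), K; split=> //; first exact: mulr_ge0.
by move=> k n; rewrite -mulrA -exprS.
Qed.

Lemma stem_seriesMr c q z : exp_bounded c -> exp_bounded (fun n => c n * q) ->
  stem_series (fun n => c n * q) z = stem_series c z * qC q.
Proof.
move=> gc gcq; have := qcvgMr (qC q) (stem_sum_cvg z gc).
apply: qcvg_unique; rewrite (_ : (fun n => _) = stem_sum (fun n => c n * q) z).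
  exact: stem_sum_cvg.
apply/funext => N; rewrite /stem_sum mulr_suml; apply: eq_bigr => n _.
by rewrite -[LHS]scalerAl qCM [in RHS]mulrA.
Qed.

Lemma stem_seriesMl c q z : exp_bounded c -> exp_bounded (fun n => q * c n) ->
  stem_series (fun n => q * c n) z = qC q * stem_series c z.
Proof.
move=> gc gcq; have := qcvgMl (qC q) (stem_sum_cvg z gc).
apply: qcvg_unique; rewrite (_ : (fun n => _) = stem_sum (fun n => q * c n) z).
  exact: stem_sum_cvg.
apply/funext => N; rewrite /stem_sum mulr_sumr; apply: eq_bigr => n _.
rewrite -[LHS]scalerAr qCM; congr (_ *: _).
rewrite [LHS]mulrA [RHS]mulrA; congr (_ * _).
by elim: n => [|n IH]; rewrite ?(expr0, mulr1, mul1r)// exprS mulrA -zeta_central -!mulrA IH.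
Qed.

Lemma stem_seriesD c d z : exp_bounded c -> exp_bounded d ->
  exp_bounded (fun n => c n + d n) ->
  stem_series (fun n => c n + d n) z = stem_series c z + stem_series d z.
Proof.
move=> gc gd gcd; have := qcvgD (stem_sum_cvg z gc) (stem_sum_cvg z gd).
apply: qcvg_unique; rewrite (_ : (fun n => _) = stem_sum (fun n => c n + d n) z).
  exact: stem_sum_cvg.
apply/funext => N; rewrite /stem_sum -big_split; apply: eq_bigr => n _.
rewrite -[LHS]scalerDr -[X in _ *: X = _]mulrDr; congr (_ *: (_ * _)).
by congr pair; rewrite /= addr0.
Qed.

Lemma expsum_conj (a : nat -> R) z N : expsum a (conjc z) N = conjc (expsum a z N).
Proof.
have cM (v w : C) : conjc (v * w) = conjc v * conjc w by exact: rmorphM.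
have cX (w : C) n : conjc (w ^+ n) = conjc w ^+ n by exact: rmorphXn.
rewrite /expsum (big_morph _ (rmorphD (@conjc R)) (rmorph0 (@conjc R))).
by apply: eq_bigr => n _; rewrite [RHS](cM _ _) cX conjc_real.
Qed.

Lemma stem_series_conj c z : exp_bounded c ->
  stem_series c (conjc z) = quatC_conj (stem_series c z).
Proof.
move=> gc; apply: (qcvg_unique (stem_sum_cvg (conjc z) gc)) => k.
have [r i] := stem_sum_cvg z gc k.
rewrite ccoord_conj; apply: (ccvg_ext (U := fun N => conjc (ccoord k (stem_sum c z N)))).
  by move=> N; rewrite !ccoord_sum expsum_conj.
have E (w : C) : Re (conjc w) = Re w /\ Im (conjc w) = - Im w by case: w.
split; rewrite ?(E _).1 ?(E _).2; under eq_fun do rewrite ?(E _).1 ?(E _).2; first exact: r.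
exact: cvgN.
Qed.

Lemma stem_series0 c : exp_bounded c -> stem_series c 0 = qC (c 0).
Proof.
move=> gc; apply: (qcvg_unique (stem_sum_cvg (0 : C) gc)) => k.
have E N : ccoord k (stem_sum c 0 N.+1) = ccoord k (qC (c 0)).
  rewrite ccoord_sum /expsum big_nat_recl// big1 ?addr0.
    by rewrite expr0 mulr1 fact0 divr1 ccoord_qC.
  by move=> n _; rewrite expr0n mulr0.
split; rewrite -cvg_shiftS.
  rewrite (_ : [sequence _]_n = fun=> Re (ccoord k (qC (c 0)))).
    exact: cvg_cst.
  by apply/funext => N; rewrite -(E N).
rewrite (_ : [sequence _]_n = fun=> Im (ccoord k (qC (c 0)))).
  exact: cvg_cst.
by apply/funext => N; rewrite -(E N).
Qed.

(** A coordinate of a product is a signed sum of four products, whence the 4; the sup norm that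
    [quat] carries is not multiplicative. *)
Lemma qcoordM_bound (A B : R) q q' : (forall k, `|qcoord k q| <= A) ->
  (forall k, `|qcoord k q'| <= B) -> forall k, `|qcoord k (q * q')| <= 4 * (A * B).
Proof.
move=> qA qB.
have p i j : `|qcoord i q * qcoord j q'| <= A * B by rewrite normrM ler_pM.
have tri (a b c d : R) : `|a| <= A * B -> `|b| <= A * B -> `|c| <= A * B ->
    `|d| <= A * B -> `|a + b + c + d| <= 4 * (A * B).
  rewrite !ler_norml => /andP[? ?] /andP[? ?] /andP[? ?] /andP[? ?]; lra.
by move=> [|[|[|k]]]; rewrite quat_mulE /=; apply: tri; rewrite ?normrN;
  [exact: (p 0 0)|exact: (p 1 1)|exact: (p 2 2)|exact: (p 3 3)
  |exact: (p 0 1)|exact: (p 1 0)|exact: (p 2 3)|exact: (p 3 2)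
  |exact: (p 0 2)|exact: (p 1 3)|exact: (p 2 0)|exact: (p 3 1)
  |exact: (p 0 3)|exact: (p 1 2)|exact: (p 2 1)|exact: (p 3 0)].
Qed.

Lemma qcoord_bound q : exists2 A : R, 0 <= A & forall k, `|qcoord k q| <= A.
Proof. by exists `|q| => // k; exact: qcoord_norm. Qed.

Lemma exp_boundedMr c q : exp_bounded c -> exp_bounded (fun n => c n * q).
Proof.
move=> [M [K [M0 K0 cMK]]]; have [A A0 qA] := qcoord_bound q.
exists (4 * (M * A)), K; split=> //; first by rewrite !mulr_ge0.
move=> k n.
have -> : 4 * (M * A) * K ^+ n = 4 * ((M * K ^+ n) * A) by ring.
exact: qcoordM_bound.
Qed.

Lemma exp_boundedMl c q : exp_bounded c -> exp_bounded (fun n => q * c n).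
Proof.
move=> [M [K [M0 K0 cMK]]]; have [A A0 qA] := qcoord_bound q.
exists (4 * (A * M)), K; split=> //; first by rewrite !mulr_ge0.
move=> k n.
have -> : 4 * (A * M) * K ^+ n = 4 * (A * (M * K ^+ n)) by ring.
exact: qcoordM_bound.
Qed.

Lemma qcoord1_bound k : `|qcoord k (1 : quat R)| <= 1.
Proof. by case: k => [|[|[|k]]]; rewrite /= /qre /qi /qj /qk /= ?normr1 ?normr0. Qed.

Lemma exp_bounded_exp q : exp_bounded (fun n => q ^+ n).
Proof.
have [A A0 qA] := qcoord_bound q; exists 1, (4 * A); split=> //; first exact: mulr_ge0.
move=> k n; rewrite mul1r; elim: n k => [|n IH] k.
  by rewrite !expr0 qcoord1_bound.
have -> : (4 * A) ^+ n.+1 = 4 * (A * (4 * A) ^+ n) by rewrite exprS; ring.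
by rewrite exprS; exact: qcoordM_bound.
Qed.

Definition gcoeff q q' n : quat R := \sum_(0 <= k < n) q ^+ k * q' ^+ (n - k - 1).

(** The coefficient form of g' = g lambda + E_mu: the summand k = n has exponent 0 at [q'], and
    every earlier one gains a factor [q']. *)
Lemma gcoeffS q q' n : gcoeff q q' n.+1 = gcoeff q q' n * q' + q ^+ n.
Proof.
rewrite /gcoeff big_nat_recr//= subSnn subnn expr0 mulr1; congr (_ + _).
rewrite mulr_suml; apply: eq_big_nat => k /andP[_ kn].
by rewrite -mulrA -exprSr; congr (_ * _ ^+ _); rewrite subSn ?(ltnW kn)// subSS subn0 subn1 prednK ?subn_gt0.
Qed.

Lemma exp_bounded_gcoeff q q' : exp_bounded (gcoeff q q').
Proof.
have [M [K [M0 K0 qMK]]] := exp_bounded_exp q.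
have [A A0 qA] := qcoord_bound q'.
(* In the recursion [gcoeffS] the multiplication by [q'] costs [4 * A] and the summand [q ^+ n]
   costs 1; the summand [K] makes [L ^+ n] dominate [K ^+ n]. *)
pose L := K + 4 * A + 1.
exists M, L; split=> //; first by rewrite !addr_ge0// mulr_ge0.
have L0 : 0 <= L by rewrite !addr_ge0// mulr_ge0.
move=> k n; elim: n k => [|n IH] k.
  by rewrite /gcoeff big_geq// qcoord0 normr0 expr0 mulr1.
rewrite gcoeffS qcoordD (le_trans (ler_normD _ _))//.
have h1 := qcoordM_bound IH qA k.
have h2 : `|qcoord k (q ^+ n)| <= M * L ^+ n.
  rewrite (le_trans (qMK k n))// ler_wpM2l// lerXn2r ?nnegrE//.
  by rewrite /L -addrA lerDl addr_ge0// mulr_ge0.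
have LM : 0 <= M * L ^+ n by rewrite mulr_ge0// exprn_ge0.
have -> : M * L ^+ n.+1 = K * (M * L ^+ n) + (4 * (M * L ^+ n * A) + M * L ^+ n).
  by rewrite exprS {1}/L; ring.
by rewrite (le_trans (lerD h1 h2))// lerDr mulr_ge0.
Qed.

Definition stem_exp q : C -> quatC R := stem_series (fun n => q ^+ n).
Definition stem_g q q' : C -> quatC R := stem_series (gcoeff q q').

Lemma stem_exp_derive q z : stem_derive (stem_exp q) z (stem_exp q z * qC q).
Proof.
have g := exp_bounded_exp q.
apply: stem_derive_eq (stem_series_derive z g) _.
rewrite -stem_seriesMr//; last exact: exp_boundedMr.
by apply: (congr1 (stem_series^~ z)); apply/funext => n; rewrite exprSr.
Qed.

Lemma stem_exp_comm q q' z : q * q' = q' * q -> qC q' * stem_exp q z = stem_exp q z * qC q'.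
Proof.
move=> qq'; have g := exp_bounded_exp q.
rewrite -stem_seriesMr//; last exact: exp_boundedMr.
rewrite -stem_seriesMl//; last exact: exp_boundedMl.
by apply: (congr1 (stem_series^~ z)); apply/funext => n; exact: (commrX n (esym qq')).
Qed.

(** By [gcoeffS] the series g is a preimage of exp_mu under D_lambda, whether or not lambda and mu
    commute. *)
Lemma stem_g_derive q q' z :
  stem_derive (stem_g q q') z (stem_g q q' z * qC q' + stem_exp q z).
Proof.
have g := exp_bounded_gcoeff q q'; have e := exp_bounded_exp q.
apply: stem_derive_eq (stem_series_derive z g) _.
have E : (fun n => gcoeff q q' n.+1) = (fun n => gcoeff q q' n * q' + q ^+ n).
  by apply/funext => n; rewrite gcoeffS.
have gr := exp_boundedMr q' g.
rewrite -stem_seriesMr// -stem_seriesD//; first by rewrite E.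
by rewrite -E; exact: exp_boundedS.
Qed.

Lemma stem_exp0 q : stem_exp q 0 = 1.
Proof. by rewrite /stem_exp (stem_series0 (exp_bounded_exp q)) expr0. Qed.

(** The product has zero derivative on the whole plane and the value 1 at 0, which avoids
    multiplying two series. *)
Lemma stem_expK q z : stem_exp q z * stem_exp (- q) z = 1.
Proof.
rewrite (@stem_derive0_cst _ (fun w => stem_exp q w * stem_exp (- q) w)).
  by rewrite !stem_exp0 mulr1.
move=> w; apply: stem_derive_eq (stem_deriveM (stem_exp_derive q w) (stem_exp_derive (- q) w)) _.
have -> : qC (- q) = - qC q by congr pair; rewrite /= oppr0.
apply: mul_comm_cancel; apply: (stem_exp_comm w).
by rewrite mulrN mulNr.
Qed.

Lemma stem_expNV q z : stem_exp (- q) z * stem_exp q z = 1.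
Proof. by have := stem_expK (- q) z; rewrite opprK. Qed.

Lemma stem_function_series D c : exp_bounded c -> stem_function D (stem_series c).
Proof. by move=> gc z _; exact: stem_series_conj. Qed.

(** The direction squares to -1 only at nonreal [x], being 0 at real ones; the factor [im_modulus x]
    makes the second identity true in both cases. *)
Lemma im_dirE x : x = (qre x)%:A + im_modulus x *: im_dir x /\
  im_modulus x *: (im_dir x * im_dir x) = - (im_modulus x)%:A.
Proof.
have m2 : im_modulus x ^+ 2 = qi x ^+ 2 + qj x ^+ 2 + qk x ^+ 2.
  by rewrite sqr_sqrtr// !addr_ge0 ?sqr_ge0.
case: x m2 => [[[a b] c] d]; rewrite /im_dir /qi /qj /qk /=.
set m := im_modulus _ => m2.
have [m0|m0] := eqVneq m 0.
  rewrite m0 !scale0r oppr0 addr0; split=> //.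
  have [b0 c0 d0] : [/\ b = 0, c = 0 & d = 0].
    move: m2; rewrite m0 expr0n /= => /esym/eqP.
    rewrite paddr_eq0 ?addr_ge0 ?sqr_ge0// paddr_eq0 ?sqr_ge0// !sqrf_eq0.
    by move=> /andP[/andP[/eqP ? /eqP ?] /eqP ?].
  by apply: quat_eqP; rewrite /qre /qi /qj /qk /= ?b0 ?c0 ?d0 /GRing.scale /=; ring.
split.
  rewrite scalerA mulfV// scale1r.
  by apply: quat_eqP; rewrite /qre /qi /qj /qk /= /GRing.scale /=; ring.
rewrite -scalerAl -scalerAr !scalerA mulfV// mul1r.
apply: quat_eqP; rewrite quat_mulE /qre /qi /qj /qk /= /qre /qi /qj /qk /= /GRing.scale /=; try ring.
apply: (mulfI m0); rewrite mulrA mulfV// mul1r.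
by have := m2; rewrite expr2 => E; lra.
Qed.

End quaternionic_series.

(** * Slice functions and the equation *)

Section ring_identities.
Variable A : pzRingType.
Implicit Types F H G E e l m : A.

(** The left side is the derivative of (F - H1 G) E_{-lambda}: [0] stands for the derivative of [H],
    [Em] for E_mu and [e] for E_{-lambda}. *)
Lemma quotient_deriv F' F H G Em e l : F' - F * l = H * Em -> l * e = e * l ->
  (F' - (0 * G + H * (G * l + Em))) * e + (F - H * G) * (e * - l) = 0.
Proof.
move=> F'E le.
have -> : F' - (0 * G + H * (G * l + Em)) = (F - H * G) * l.
  rewrite -[F'](subrK (F * l)) F'E mul0r add0r mulrDr mulrBl mulrA.
  by rewrite [H * G * l + _]addrC opprD addrACA subrr add0r.
exact: mul_comm_cancel.
Qed.

Lemma quotient_recover F H G e E : e * E = 1 -> F = H * G + (F - H * G) * e * E.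
Proof. by move=> eE; rewrite -mulrA eE mulr1 addrC subrK. Qed.

Lemma combination_deriv H1 H2 G E Em l :
  (0 * G + H1 * (G * l + Em)) + (0 * E + H2 * (E * l)) - (H1 * G + H2 * E) * l =
  H1 * Em.
Proof.
rewrite !mul0r !add0r mulrDr mulrDl !mulrA.
by rewrite [X in X + _ - _]addrC -[X in X - _]addrA addrK.
Qed.

(** With [c] the inverse of mu - lambda, this passes from the preimage G to the pair E_mu, E_lambda.
    Coefficients stand on the left, so [c] must be moved across the exponentials. *)
Lemma change_basis H1 H2 c E1 E2 : c * E1 = E1 * c -> c * E2 = E2 * c ->
  H1 * ((E1 - E2) * c) + H2 * E2 = H1 * c * E1 + (H2 - H1 * c) * E2.
Proof.
move=> c1 c2; rewrite [(E1 - E2) * c]mulrBl -c1 -c2 mulrBr !mulrA mulrBl.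
by rewrite -addrA [- _ + _]addrC.
Qed.

Lemma change_basis_inv H1 H2 c m E1 E2 : c * E1 = E1 * c -> c * E2 = E2 * c ->
  m * c = 1 -> H1 * E1 + H2 * E2 = H1 * m * ((E1 - E2) * c) + (H2 + H1) * E2.
Proof.
move=> c1 c2 mc; rewrite change_basis// -[H1 * m * c]mulrA mc mulr1.
by rewrite addrK.
Qed.

Lemma one_zero_combination G E : 1 * G + 0 * E = G.
Proof. by rewrite mul1r mul0r addr0. Qed.

Lemma product_deriv z E l : 1 * E + z * (E * l) = z * E * l + E.
Proof. by rewrite mul1r mulrA addrC. Qed.

Lemma inverse_comm (p q c : A) : q * c = 1 -> c * q = 1 -> p * q = q * p ->
  c * p = p * c.
Proof.
move=> qc cq pq; rewrite -[LHS]mulr1 -qc mulrA -[c * p * q]mulrA pq.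
by rewrite mulrA cq mul1r.
Qed.

(** Shows that (E_mu - E_lambda) (mu - lambda)^{-1} is mapped to E_mu by D_lambda; its derivative is
    the left side. *)
Lemma exp_difference_deriv E1 E2 m l c : (m - l) * c = 1 -> c * l = l * c ->
  (E1 * m - E2 * l) * c = (E1 - E2) * c * l + E1.
Proof.
move=> mlc cl; have -> : E1 * m - E2 * l = (E1 - E2) * l + E1 * (m - l).
  by rewrite mulrBl mulrBr [RHS]addrC [RHS]addrA subrK.
by rewrite mulrDl -!mulrA mlc mulr1 cl.
Qed.

End ring_identities.

(** * Transfer between slice functions and stem functions *)

Section slice_level.
Variable R : realType.
Local Notation C := R[i].
Implicit Types (q x lambda mu : quat R) (u v : quatC R) (c : nat -> quat R) (z w : C) (k n N : nat).
Implicit Types (F G H : C -> quatC R) (f g h : quat R -> quat R).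

Definition slice_point x : C := qre x +i* im_modulus x.
Definition slice_eval x u : quat R := u.1 + im_dir x * u.2.

Lemma slice_funD F G x :
  slice_fun (fun z => F z + G z) x = slice_fun F x + slice_fun G x.
Proof. by rewrite /slice_fun /= mulrDr addrACA. Qed.

Lemma slice_funB F G x :
  slice_fun (fun z => F z - G z) x = slice_fun F x - slice_fun G x.
Proof. by rewrite /slice_fun /= mulrBr opprD addrACA. Qed.

Lemma slice_funMr F q x :
  slice_fun (fun z => F z * qC q) x = slice_fun F x * q.
Proof.
by rewrite /slice_fun quatC_mulE /quatC_mul /= !mulr0 subr0 add0r mulrDl mulrA.
Qed.

(** Evaluation at [x] is not multiplicative on H (x) C, but the central variable does turn into left
    multiplication by [x]. This is how powers of [x] in a series become powers of [zeta]. *)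
Lemma slice_eval_zeta x u : slice_eval x (zeta (slice_point x) * u) = x * slice_eval x u.
Proof.
have [xE II] := im_dirE x.
have key (a b : R) (J u1 u2 : quat R) : b *: (J * J) = - b%:A ->
    (a%:A + b *: J) * (u1 + J * u2) = (a *: u1 - b *: u2) + J * (a *: u2 + b *: u1).
  move=> JJ; rewrite mulrDl !mulrDr -!scalerAl !mul1r -!scalerAr !mulrA.
  have -> : b *: (J * J * u2) = - (b *: u2) by rewrite scalerAl JJ mulNr -scalerAl mul1r.
  by rewrite -!addrA; congr (_ + _); rewrite [b *: _ - _]addrC addrCA.
by rewrite [X in _ = X * _]xE key// /slice_eval zetaMl_fst zetaMl_snd.
Qed.

Lemma slice_fun_zeta F x : slice_fun (fun z => zeta z * F z) x = x * slice_fun F x.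
Proof. exact: slice_eval_zeta. Qed.

Lemma slice_eval_sum x c N :
  \sum_(0 <= n < N) (n`!%:R^-1 : R) *: (x ^+ n * c n) =
  slice_eval x (stem_sum c (slice_point x) N).
Proof.
have evD u v : slice_eval x (u + v) = slice_eval x u + slice_eval x v.
  by rewrite /slice_eval /= mulrDr addrACA.
have ev0 : slice_eval x 0 = 0 by rewrite /slice_eval /= mulr0 addr0.
have evZ (a : R) u : slice_eval x (a *: u) = a *: slice_eval x u.
  by rewrite /slice_eval /= scalerDr -scalerAr.
rewrite /stem_sum (big_morph _ evD ev0); apply: eq_bigr => n _.
rewrite evZ; congr (_ *: _).
have cE : c n = slice_eval x (qC (c n)) by rewrite /slice_eval /= mulr0 addr0.
rewrite [X in _ * X = _]cE {cE}.
elim: n (qC (c n)) => [|n IH] u; first by rewrite !expr0 !mul1r.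
rewrite exprS -mulrA IH -slice_eval_zeta; congr slice_eval.
by rewrite mulrA exprS.
Qed.

Lemma quat_cvg (U : nat -> quat R) q :
  (forall k, (fun n => qcoord k (U n)) @ \oo --> qcoord k q) -> U @ \oo --> q.
Proof.
move=> Uq; apply/cvgrPdist_lt => e e0.
have H k : \forall n \near \oo, `|qcoord k (q - U n)| < e.
  have /cvgrPdist_lt/(_ e e0) := Uq k.
  by apply: filterS => n; rewrite qcoordD qcoordN.
near=> n; apply: qnorm_lt => k.
have h0 : `|qcoord 0 (q - U n)| < e by near: n; exact: H.
have h1 : `|qcoord 1 (q - U n)| < e by near: n; exact: H.
have h2 : `|qcoord 2 (q - U n)| < e by near: n; exact: H.
have h3 : `|qcoord 3 (q - U n)| < e by near: n; exact: H.
by case: k => [|[|[|k]]].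
Unshelve. all: by end_near. Qed.

Lemma slice_eval_cvg (U : nat -> quatC R) u x : qcvg U u ->
  (fun n => slice_eval x (U n)) @ \oo --> slice_eval x u.
Proof.
move=> Uu; apply: quat_cvg => k.
have c1 j : (fun n => qcoord j (U n).1) @ \oo --> qcoord j u.1 := (Uu j).1.
have c2 j (a : R) : (fun n => a * qcoord j (U n).2) @ \oo --> a * qcoord j u.2.
  by apply: cvgM; [exact: cvg_cst|exact: (Uu j).2].
rewrite /slice_eval qcoordD; under eq_fun do rewrite qcoordD.
apply: cvgD (c1 k) _; rewrite quat_mulE /quat_mul.
case: k => [|[|[|k]]] /=.
- exact: cvgB (cvgB (cvgB (c2 0 _) (c2 1 _)) (c2 2 _)) (c2 3 _).
- exact: cvgB (cvgD (cvgD (c2 1 _) (c2 0 _)) (c2 3 _)) (c2 2 _).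
- exact: cvgD (cvgD (cvgB (c2 2 _) (c2 3 _)) (c2 0 _)) (c2 1 _).
- exact: cvgD (cvgB (cvgD (c2 3 _) (c2 2 _)) (c2 1 _)) (c2 0 _).
Qed.

Lemma slice_series_lim x c : exp_bounded c ->
  limn (fun N => \sum_(0 <= n < N) (n`!%:R^-1 : R) *: (x ^+ n * c n)) =
  slice_fun (stem_series c) x.
Proof.
move=> gc; apply: cvg_lim; first exact: norm_hausdorff.
under eq_fun do rewrite slice_eval_sum.
exact: slice_eval_cvg (stem_sum_cvg _ gc).
Qed.

Lemma slice_expE lambda x : slice_exp lambda x = slice_fun (stem_exp lambda) x.
Proof. exact: (slice_series_lim x (exp_bounded_exp lambda)). Qed.

Lemma slice_gE mu lambda x : slice_g mu lambda x = slice_fun (stem_g mu lambda) x.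
Proof.
rewrite -(slice_series_lim x (exp_bounded_gcoeff mu lambda)) /slice_g.
(* The series of g starts at n = 1 and [stem_g] at n = 0; the extra coefficient [gcoeff mu lambda 0]
   is an empty sum, and for N = 0 both partial sums are empty. *)
congr (lim _); congr (_ @ \oo); apply/funext => -[|N]; first by rewrite !big_geq.
have g0 : gcoeff mu lambda 0 = 0 by rewrite /gcoeff big_geq.
by rewrite [RHS]big_ltn// g0 mulr0 scaler0 add0r.
Qed.

Section domain.
Variable D : set C.
Hypothesis hD : axially_symmetric_domain D.

Lemma domain_open : open D. Proof. by case: hD. Qed.
Lemma domain_conj z : D z -> D (conjc z). Proof. by case: hD => _ + _ _; apply. Qed.

Lemma slice_point_in x : x \in Omega D -> D (slice_point x).
Proof.
rewrite inE => -[a [b [J [Dab SJ ->]]]].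
rewrite /slice_point qre_slice// im_modulus_slice//.
by have [b0|b0] := ger0P b; [|exact: (domain_conj Dab)].
Qed.

Lemma eq_slice_fun F G : (forall z, D z -> F z = G z) ->
  {in Omega D, slice_fun F =1 slice_fun G}.
Proof. by move=> FG x /slice_point_in xD; rewrite /slice_fun FG. Qed.

Lemma stem_ofE f F z : stem_function D F -> {in Omega D, f =1 slice_fun F} ->
  D z -> stem_of D f z = F z.
Proof.
by move=> sF fF Dz; apply: (stem_of_unique domain_conj sF fF); rewrite inE.
Qed.

(** Pulls an equation between slice functions on [Omega D] back to the stem functions on [D]. *)
Lemma slice_fun_inj F G z : stem_function D F -> stem_function D G ->
  {in Omega D, slice_fun F =1 slice_fun G} -> D z -> F z = G z.
Proof.
move=> sF sG FG Dz; rewrite -(stem_ofE (f := slice_fun F) sF)//.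
exact: (stem_ofE sG FG Dz).
Qed.

Lemma stem_deriv_dz F z : holomorphic_stem D F -> D z -> stem_derive F z (dz F z).
Proof. exact: holomorphic_stem_cderive domain_open. Qed.

Lemma dz_eq F G z : holomorphic_stem D F -> (forall w, D w -> F w = G w) ->
  D z -> dz G z = dz F z.
Proof.
move=> hF FG Dz.
by have /stem_derive_d[_ _ -> _] := stem_derive_near domain_open Dz FG (stem_deriv_dz hF Dz).
Qed.

Lemma holomorphic_dz F : holomorphic_stem D F -> holomorphic_stem D (dz F).
Proof. exact: holomorphic_stem_dz domain_open domain_conj. Qed.

(** Continuity of [F'] is obtained from its differentiability, so class C1 is verified by
    differentiating a second time. *)
Lemma holomorphic_of_derive F (F' : C -> quatC R) : stem_function D F ->
  (forall z, D z -> stem_derive F z (F' z)) ->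
  (forall z, D z -> exists u, stem_derive F' z u) ->
  holomorphic_stem D F.
Proof.
move=> sF FF' F'd; apply: (holomorphic_stemI domain_open sF FF') => z Dz.
by have [u /stem_derive_continuous] := F'd z Dz.
Qed.

Lemma slice_deriv_stem f F : holomorphic_stem D F -> {in Omega D, f =1 slice_fun F} ->
  {in Omega D, slice_deriv D f =1 slice_fun (dz F)}.
Proof.
move=> hF fF; apply: eq_slice_fun => z Dz; apply: dz_eq => // w Dw.
by rewrite (stem_ofE _ fF)//; have [] := hF.
Qed.

Definition stem_D lambda F z : quatC R := dz F z - F z * qC lambda.

Lemma slice_D_stem lambda f F : holomorphic_stem D F ->
  {in Omega D, f =1 slice_fun F} ->
  {in Omega D, slice_D D lambda f =1 slice_fun (stem_D lambda F)}.
Proof.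
move=> hF fF x xD; rewrite /slice_D /stem_D (slice_deriv_stem hF fF)// fF//.
by rewrite (slice_funB (dz F) (fun z => F z * qC lambda)) slice_funMr.
Qed.

Lemma quatC_conjM u v : quatC_conj (u * v) = quatC_conj u * quatC_conj v.
Proof.
rewrite !quatC_mulE /quatC_conj /quatC_mul /=; congr pair.
  by rewrite mulrNN.
by rewrite mulrN mulNr opprD.
Qed.

Lemma quatC_conjD u v : quatC_conj (u + v) = quatC_conj u + quatC_conj v.
Proof. by congr pair; rewrite /= opprD. Qed.

Lemma quatC_conjN u : quatC_conj (- u) = - quatC_conj u.
Proof. by []. Qed.

Lemma quatC_conj_qC q : quatC_conj (qC q) = qC q.
Proof. by congr pair; rewrite /= oppr0. Qed.

Lemma quatC_conj0 : quatC_conj 0 = 0 :> quatC R.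
Proof. exact: (quatC_conj_qC 0). Qed.

Lemma stem_functionM F G : stem_function D F -> stem_function D G ->
  stem_function D (fun z => F z * G z).
Proof. by move=> sF sG z Dz; rewrite sF// sG// quatC_conjM. Qed.

Lemma stem_functionD F G : stem_function D F -> stem_function D G ->
  stem_function D (fun z => F z + G z).
Proof. by move=> sF sG z Dz; rewrite sF// sG// quatC_conjD. Qed.

Lemma stem_functionB F G : stem_function D F -> stem_function D G ->
  stem_function D (fun z => F z - G z).
Proof. by move=> sF sG z Dz; rewrite sF// sG// quatC_conjD quatC_conjN. Qed.

Lemma stem_function_qC q : stem_function D (fun=> qC q).
Proof. by move=> z _; rewrite quatC_conj_qC. Qed.

Lemma holomorphic_stem_D lambda F : holomorphic_stem D F ->
  holomorphic_stem D (stem_D lambda F).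
Proof.
move=> hF; have hdF := holomorphic_dz hF; have hddF := holomorphic_dz hdF.
have [sF _ _] := hF; have [sdF _ _] := hdF.
apply: (holomorphic_of_derive (F' := fun z => dz (dz F) z - dz F z * qC lambda)).
- by apply: stem_functionB => //; apply: stem_functionM => //; exact: stem_function_qC.
- move=> z Dz; apply: stem_deriveB; first exact: stem_deriv_dz.
  by apply: stem_deriveMr; exact: stem_deriv_dz.
(* A third derivative of [F] appears because [holomorphic_of_derive] asks that the derivative of
   [stem_D lambda F] be differentiable. *)
- move=> z Dz; exists (dz (dz (dz F)) z - dz (dz F) z * qC lambda).
  apply: stem_deriveB; first exact: stem_deriv_dz.
  by apply: stem_deriveMr; exact: stem_deriv_dz.
Qed.

Lemma solution_stem mu lambda f : solution D mu lambda f <->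
  exists F, [/\ holomorphic_stem D F, {in Omega D, f =1 slice_fun F} &
    forall z, D z -> stem_D mu (stem_D lambda F) z = 0].
Proof.
have DD F : holomorphic_stem D F -> {in Omega D, f =1 slice_fun F} ->
    {in Omega D, slice_D D mu (slice_D D lambda f) =1
       slice_fun (stem_D mu (stem_D lambda F))}.
  move=> hF fF; apply: slice_D_stem; first exact: holomorphic_stem_D.
  exact: slice_D_stem.
have zero x : slice_fun (fun=> 0 : quatC R) x = 0 by rewrite /slice_fun /= mulr0 addr0.
split=> [[[F hF fF] sol]|[F [hF fF sol]]].
  exists F; split=> // z Dz.
  have [sP _ _] := holomorphic_stem_D mu (holomorphic_stem_D lambda hF).
  apply: (slice_fun_inj (G := fun=> 0) sP _ _ Dz).
    by move=> w _; rewrite quatC_conj0.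
  by move=> x xD; rewrite -DD// sol// zero.
split; first by exists F.
by move=> x xD; rewrite (DD F)// (eq_slice_fun sol)// zero.
Qed.

(** Not simply a quaternion: [D] may consist of two conjugate pieces while [Omega D] is connected,
    and then the value may be a + iota b on one piece and a - iota b on the other. *)
Definition constant_stem H :=
  stem_function D H /\ forall z, D z -> stem_derive H z 0.

Lemma constant_stem_qC q : constant_stem (fun=> qC q).
Proof. by split; [exact: stem_function_qC|move=> z _; exact: stem_derive_cst]. Qed.

Lemma constant_stemMr H q : constant_stem H -> constant_stem (fun z => H z * qC q).
Proof.
move=> [sH dH]; split; first by apply: stem_functionM => //; exact: stem_function_qC.
by move=> z Dz; rewrite -[0](mul0r (qC q)); apply: stem_deriveMr; exact: dH.
Qed.

Lemma constant_stemB H G : constant_stem H -> constant_stem G ->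
  constant_stem (fun z => H z - G z).
Proof.
move=> [sH dH] [sG dG]; split; first exact: stem_functionB.
by move=> z Dz; rewrite -[0]subr0; apply: stem_deriveB; [exact: dH|exact: dG].
Qed.

Lemma constant_stemD H G : constant_stem H -> constant_stem G ->
  constant_stem (fun z => H z + G z).
Proof.
move=> [sH dH] [sG dG]; split; first exact: stem_functionD.
by move=> z Dz; rewrite -[0]addr0; apply: stem_deriveD; [exact: dH|exact: dG].
Qed.

Lemma constant_stem_holomorphic H : constant_stem H -> holomorphic_stem D H.
Proof.
move=> [sH dH]; apply: (holomorphic_of_derive (F' := fun=> 0)) => //.
by move=> z _; exists 0; exact: stem_derive_cst.
Qed.

Lemma slice_constantP h : slice_constant D h <->
  exists2 H, constant_stem H & {in Omega D, h =1 slice_fun H}.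
Proof.
have zero x : slice_fun (fun=> 0 : quatC R) x = 0 by rewrite /slice_fun /= mulr0 addr0.
have s0 : stem_function D (fun=> 0 : quatC R).
  by move=> w _; rewrite quatC_conj0.
split=> [[[H hH hHE] h0]|[H cH hE]].
  exists H => //; split; first by have [] := hH.
  move=> z Dz; have := stem_deriv_dz hH Dz.
  have [sdH _ _] := holomorphic_dz hH.
  rewrite (slice_fun_inj sdH s0 _ Dz)// => x xD.
  by rewrite -(slice_deriv_stem hH hHE)// h0// zero.
have hH := constant_stem_holomorphic cH.
split; first by exists H.
move=> x xD; rewrite (slice_deriv_stem hH hE)// -[RHS](zero x).
apply: eq_slice_fun xD => z Dz.
by have /stem_derive_d[_ _ -> _] := cH.2 z Dz.
Qed.

Lemma slice_mul_stem h g H G : stem_function D H -> stem_function D G ->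
  {in Omega D, h =1 slice_fun H} -> {in Omega D, g =1 slice_fun G} ->
  {in Omega D, slice_mul D h g =1 slice_fun (fun z => H z * G z)}.
Proof.
move=> sH sG hH gG; apply: eq_slice_fun => z Dz.
by rewrite (stem_ofE sH hH)// (stem_ofE sG gG).
Qed.

(** Reduces the three claims about slice products to pointwise identities between stem functions. *)
Lemma slice_combinationP f g1 g2 G1 G2 : stem_function D G1 -> stem_function D G2 ->
  {in Omega D, g1 =1 slice_fun G1} -> {in Omega D, g2 =1 slice_fun G2} ->
  (exists h1 h2, [/\ slice_constant D h1, slice_constant D h2 &
     {in Omega D, forall x, f x = slice_mul D h1 g1 x + slice_mul D h2 g2 x}]) <->
  (exists H1 H2, [/\ constant_stem H1, constant_stem H2 &
     {in Omega D, f =1 slice_fun (fun z => H1 z * G1 z + H2 z * G2 z)}]).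
Proof.
move=> sG1 sG2 gG1 gG2; split=> [[h1 [h2 [c1 c2 fE]]]|[H1 [H2 [c1 c2 fE]]]].
  have [H1 cH1 hH1] := (slice_constantP h1).1 c1.
  have [H2 cH2 hH2] := (slice_constantP h2).1 c2.
  exists H1, H2; split=> // x xD.
  rewrite fE// (slice_mul_stem cH1.1 sG1 hH1 gG1)// (slice_mul_stem cH2.1 sG2 hH2 gG2)//.
  by rewrite (slice_funD (fun z => H1 z * G1 z) (fun z => H2 z * G2 z)).
exists (slice_fun H1), (slice_fun H2); split.
- by apply/slice_constantP; exists H1.
- by apply/slice_constantP; exists H2.
- move=> x xD.
  rewrite fE// (slice_mul_stem c1.1 sG1 _ gG1)// (slice_mul_stem c2.1 sG2 _ gG2)//.
  by rewrite (slice_funD (fun z => H1 z * G1 z) (fun z => H2 z * G2 z)).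
Qed.

Section fundamental.
(* The hypothesis dG says that G is a preimage of exp_mu under D_lambda. *)
Variables (mu lambda : quat R) (G : C -> quatC R).
Hypotheses (sG : stem_function D G)
  (dG : forall z, stem_derive G z (G z * qC lambda + stem_exp mu z)).

Lemma stem_function_stem_exp q : stem_function D (stem_exp q).
Proof. exact: stem_function_series (exp_bounded_exp q). Qed.

Lemma combination_solution H1 H2 : constant_stem H1 -> constant_stem H2 ->
  let F z := H1 z * G z + H2 z * stem_exp lambda z in
  holomorphic_stem D F /\ forall z, D z -> stem_D mu (stem_D lambda F) z = 0.
Proof.
move=> [sH1 dH1] [sH2 dH2] F.
pose F' z := (0 * G z + H1 z * (G z * qC lambda + stem_exp mu z)) +
             (0 * stem_exp lambda z + H2 z * (stem_exp lambda z * qC lambda)).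
have FF' z : D z -> stem_derive F z (F' z).
  move=> Dz; apply: stem_deriveD; apply: stem_deriveM.
  - exact: dH1.
  - exact: dG.
  - exact: dH2.
  - exact: stem_exp_derive.
have hF : holomorphic_stem D F.
  apply: (holomorphic_of_derive (F' := F')) => //.
    apply: stem_functionD; apply: stem_functionM => //; exact: stem_function_stem_exp.
  (* Only the existence of a derivative of [F'] matters; its value is left to unification. *)
  move=> z Dz; eexists; apply: stem_deriveD; apply: stem_deriveD; apply: stem_deriveM.
  - exact: stem_derive_cst.
  - exact: dG.
  - exact: dH1.
  - by apply: stem_deriveD; [apply: stem_deriveMr; exact: dG|exact: stem_exp_derive].
  - exact: stem_derive_cst.
  - exact: stem_exp_derive.
  - exact: dH2.
  - by apply: stem_deriveMr; exact: stem_exp_derive.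
split=> // z Dz.
(* D_lambda annihilates the second summand and sends the first to H1 E_mu, which D_mu annihilates in
   turn. *)
have PE w : D w -> H1 w * stem_exp mu w = stem_D lambda F w.
  move=> Dw; rewrite /stem_D; have /stem_derive_d[_ _ -> _] := FF' w Dw.
  exact/esym/combination_deriv.
have dP : stem_derive (fun w => H1 w * stem_exp mu w) z (H1 z * (stem_exp mu z * qC mu)).
  apply: stem_derive_eq (stem_deriveM (dH1 z Dz) (stem_exp_derive mu z)) _.
  by rewrite mul0r add0r.
have /stem_derive_d[_ _ dPE _] := stem_derive_near domain_open Dz PE dP.
rewrite /(stem_D mu) dPE -(PE z Dz).
by apply/eqP; rewrite subr_eq0; apply/eqP; exact: mulrA.
Qed.

Lemma qCN q : qC (- q) = - qC q.
Proof. by congr pair; rewrite /= oppr0. Qed.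

Lemma solution_combination F : holomorphic_stem D F ->
  (forall z, D z -> stem_D mu (stem_D lambda F) z = 0) ->
  exists H1 H2, [/\ constant_stem H1, constant_stem H2 &
    forall z, D z -> F z = H1 z * G z + H2 z * stem_exp lambda z].
Proof.
move=> hF sol; pose P := stem_D lambda F.
have hP : holomorphic_stem D P := holomorphic_stem_D lambda hF.
have [sF _ _] := hF; have [sP _ _] := hP.
pose H1 z := P z * stem_exp (- mu) z.
have dH1 z : D z -> stem_derive H1 z 0.
  move=> Dz; have dPE : dz P z = P z * qC mu.
    by have := sol z Dz; rewrite /(stem_D mu) => /eqP; rewrite subr_eq0 => /eqP.
  apply: stem_derive_eq (stem_deriveM (stem_deriv_dz hP Dz) (stem_exp_derive (- mu) z)) _.
  rewrite dPE qCN; apply: mul_comm_cancel; apply: (stem_exp_comm z).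
  by rewrite mulrN mulNr.
have H1E z : P z = H1 z * stem_exp mu z.
  by rewrite /H1 -[RHS]mulrA stem_expNV mulr1.
pose H2 z := (F z - H1 z * G z) * stem_exp (- lambda) z.
have sH1 : stem_function D H1.
  by apply: stem_functionM => //; exact: stem_function_stem_exp.
have dH2 z : D z -> stem_derive H2 z 0.
  move=> Dz; apply: stem_derive_eq (stem_deriveM (stem_deriveB (stem_deriv_dz hF Dz)
    (stem_deriveM (dH1 z Dz) (dG z))) (stem_exp_derive (- lambda) z)) _.
  rewrite qCN; apply: quotient_deriv; first exact: H1E.
  by apply: (stem_exp_comm z); rewrite mulrN mulNr.
exists H1, H2; split.
- by split.
- split; last exact: dH2.
  apply: (stem_functionM (F := fun z => F z - H1 z * G z)) (stem_function_stem_exp _).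
  exact: stem_functionB sF (stem_functionM sH1 sG).
- move=> z Dz; exact: quotient_recover (stem_expNV lambda z).
Qed.

Lemma solutionP f : solution D mu lambda f <->
  exists H1 H2, [/\ constant_stem H1, constant_stem H2 &
     {in Omega D, f =1 slice_fun (fun z => H1 z * G z + H2 z * stem_exp lambda z)}].
Proof.
split=> [/solution_stem[F [hF fF sol]]|[H1 [H2 [c1 c2 fE]]]].
  have [H1 [H2 [c1 c2 FE]]] := solution_combination hF sol.
  exists H1, H2; split=> // x xD; rewrite fF//.
  exact: eq_slice_fun xD.
have [hF sol] := combination_solution c1 c2.
by apply/solution_stem; eexists; split; [exact: hF|exact: fE|exact: sol].
Qed.

End fundamental.

Lemma quat_inverse q : q <> 0 -> exists2 c : quat R, q * c = 1 & c * q = 1.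
Proof.
move=> q0; pose n := qre q ^+ 2 + qi q ^+ 2 + qj q ^+ 2 + qk q ^+ 2.
have n0 : n != 0.
  apply/eqP => /eqP; rewrite /n !paddr_eq0 ?addr_ge0 ?sqr_ge0// !sqrf_eq0.
  move=> /andP[/andP[/andP[/eqP a /eqP b] /eqP c] /eqP d].
  by apply: q0; apply: quat_eqP.
exists (n^-1 *: ((qre q, - qi q, - qj q, - qk q) : quat R)).
  apply: (scalerI n0); rewrite -scalerAr scalerA mulfV// scale1r.
  by apply: quat_eqP; rewrite quat_mulE /n; case: (q) => [[[a b] c] d];
    rewrite /qre /qi /qj /qk /= /qre /qi /qj /qk /= /GRing.scale /=; ring.
apply: (scalerI n0); rewrite -scalerAl scalerA mulfV// scale1r.
by apply: quat_eqP; rewrite quat_mulE /n; case: (q) => [[[a b] c] d];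
  rewrite /qre /qi /qj /qk /= /qre /qi /qj /qk /= /GRing.scale /=; ring.
Qed.

Lemma zeta_derive z : stem_derive (@zeta R) z 1.
Proof.
move=> k; have E w : ccoord k (zeta w) = w * ccoord k 1.
  by rewrite -ccoord_zeta mulr1.
apply: (cderive_ext (fun w => esym (E w))).
have := cderiveM (is_derive_id z 1) (is_derive_cst (ccoord k (1 : quatC R)) z 1).
by rewrite mulr0 addr0 mul1r.
Qed.

Lemma stem_function_zeta : stem_function D (@zeta R).
Proof.
by move=> [a b] _; congr pair; rewrite /= scaleNr.
Qed.

End domain.

End slice_level.

Theorem corollary11 (R : realType) (D : set R[i]) (lambda mu : quat R)
    (hD : axially_symmetric_domain D) :
  (lambda <> mu ->
     solution D mu lambda (slice_g mu lambda) /\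
     forall f : quat R -> quat R, solution D mu lambda f ->
       exists h1 h2 : quat R -> quat R,
         [/\ slice_constant D h1, slice_constant D h2 &
             {in Omega D, forall x,
               f x = slice_mul D h1 (slice_g mu lambda) x
                   + slice_mul D h2 (slice_exp lambda) x}])
  /\
  (lambda <> mu -> lambda * mu = mu * lambda ->
     forall f : quat R -> quat R, solution D mu lambda f <->
       exists h1 h2 : quat R -> quat R,
         [/\ slice_constant D h1, slice_constant D h2 &
             {in Omega D, forall x,
               f x = slice_mul D h1 (slice_exp mu) x
                   + slice_mul D h2 (slice_exp lambda) x}])
  /\
  (lambda = mu ->
     forall f : quat R -> quat R, solution D mu lambda f <->
       exists h1 h2 : quat R -> quat R,
         [/\ slice_constant D h1, slice_constant D h2 &
             {in Omega D, forall x,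
               f x = slice_mul D h1 (slice_exp lambda) x
                   + slice_mul D h2 (fun y => y * slice_exp lambda y) x}]).
Proof.
have sE q : stem_function D (stem_exp q) by exact: stem_function_stem_exp.
have eE q : {in Omega D, slice_exp q =1 slice_fun (stem_exp q)}.
  by move=> x _; exact: slice_expE.
split; [|split].
- move=> _.
  have sG : stem_function D (stem_g mu lambda).
    exact: stem_function_series (exp_bounded_gcoeff mu lambda).
  have gE : {in Omega D, slice_g mu lambda =1 slice_fun (stem_g mu lambda)}.
    by move=> x _; exact: slice_gE.
  have solP f := solutionP hD sG (stem_g_derive mu lambda) f.
  split.
    apply/solP; exists (fun=> qC 1), (fun=> qC 0).
    split; [exact: constant_stem_qC|exact: constant_stem_qC|].
    move=> x xD; rewrite gE//; apply: (eq_slice_fun hD) xD => z _.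
    by apply/esym; exact: one_zero_combination.
  by move=> f /solP/(slice_combinationP hD f sG (sE lambda) gE (eE lambda)).
- move=> lm lmC f.
  have [c mlc cml] : exists2 c, (mu - lambda) * c = 1 & c * (mu - lambda) = 1.
    by apply: quat_inverse => /eqP; rewrite subr_eq0 => /eqP/esym.
  have cl : lambda * c = c * lambda.
    by apply/esym/(inverse_comm mlc cml); rewrite mulrBl mulrBr lmC.
  have cm : mu * c = c * mu.
    by apply/esym/(inverse_comm mlc cml); rewrite mulrBl mulrBr lmC.
  pose G z := (stem_exp mu z - stem_exp lambda z) * qC c.
  have sG : stem_function D G.
    apply: (stem_functionM (F := fun z => stem_exp mu z - stem_exp lambda z)).
      exact: stem_functionB.
    exact: stem_function_qC.
  have dG z : stem_derive G z (G z * qC lambda + stem_exp mu z).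
    apply: stem_derive_eq (stem_deriveMr _ (stem_deriveB (stem_exp_derive mu z)
      (stem_exp_derive lambda z))) _.
    apply: exp_difference_deriv; last by rewrite -!qCM cl.
    by rewrite -qCB -qCM mlc.
  have cE q z : q * c = c * q -> qC c * stem_exp q z = stem_exp q z * qC c := @stem_exp_comm R q c z.
  apply: (iff_trans (solutionP hD sG dG f)).
  apply: (iff_trans _ (iff_sym
    (slice_combinationP hD f (sE mu) (sE lambda) (eE mu) (eE lambda)))).
  split=> -[H1 [H2 [c1 c2 fE]]].
    exists (fun z => H1 z * qC c), (fun z => H2 z - H1 z * qC c); split.
    + exact: constant_stemMr.
    + exact: (constant_stemB c2 (constant_stemMr c c1)).
    + move=> x xD; rewrite fE//; apply: (eq_slice_fun hD) xD => z _.
      exact: change_basis (cE mu z cm) (cE lambda z cl).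
  (* These coefficients invert the preceding substitution: the factor mu - lambda cancels [c], and
     adding [H1] restores the E_lambda part that G subtracts. *)
  exists (fun z => H1 z * qC (mu - lambda)), (fun z => H2 z + H1 z); split.
  + exact: constant_stemMr.
  + exact: constant_stemD.
  + move=> x xD; rewrite fE//; apply: (eq_slice_fun hD) xD => z _.
    apply: change_basis_inv (cE mu z cm) (cE lambda z cl) _.
    by rewrite -qCM mlc.
- move=> <- f.
  pose G z := zeta z * stem_exp lambda z.
  have sG : stem_function D G.
    exact: (stem_functionM (@stem_function_zeta R D) (sE lambda)).
  have dG z : stem_derive G z (G z * qC lambda + stem_exp lambda z).
    apply: stem_derive_eq (stem_deriveM (zeta_derive z) (stem_exp_derive lambda z)) _.
    exact: product_deriv.
  have gE : {in Omega D, (fun y => y * slice_exp lambda y) =1 slice_fun G}.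
    by move=> x _; rewrite /= slice_expE -slice_fun_zeta.
  apply: (iff_trans (solutionP hD sG dG f)).
  apply: (iff_trans _ (iff_sym (slice_combinationP hD f (sE lambda) sG (eE lambda) gE))).
  (* The coefficients are swapped because [solutionP] lists the preimage G first, while the claim
     lists the exponential first. *)
  by split=> -[H1 [H2 [c1 c2 fE]]]; exists H2, H1; split=> // x xD;
    rewrite fE//; apply: (eq_slice_fun hD) xD => z _; exact: addrC.
Qed.
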